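(* Let $\mathbf{k}$ be a field, $\mathcal{O}=\mathbf{k}[[t]]$, $A=\mathbf{k}((t))$, and let $M$ be an $\mathcal{O}$-submodule of $V=A^n$. Put $k=\dim_A\widetilde{M}$, $r=\dim_A(AM)-\dim_A\widetilde{M}$ and $\ell=n-k-r$. Then the orbit $GL_n(A)M$ is isomorphic to $GL_n(A)/G_M$, and it is a fibre bundle, via the $GL_n(A)$-equivariant map $\rho$, over the generalised flag variety $\mathfrak{Fl}_{k,r,\ell}(A)$ of type $(k,r,\ell)\in\mathbb{Z}_{\geq 0}^3$ over the field $A$, with fibre isomorphic to the affine Grassmannian $GL_r(A)/GL_r(\mathcal{O})$. In particular, when $r=n$, the orbit is the affine Grassmannian $GL_n(A)/GL_n(\mathcal{O})$.
   Context: $GL_n(A)$ acts on the set $\mathcal{G}_n(\mathcal{O})$ of all $\mathcal{O}$-submodules of $A^n$ by $g\cdot M=g(M)$, and $G_M=\{g\in GL_n(A)\mid gM=M\}$. $\widetilde{M}=\{x\in M\mid Ax\subseteq M\}$, an $A$-subspace of $A^n$; $AM$ is the $A$-span of $M$. For nonnegative integers $d_1+d_2+d_3=n$, $\mathfrak{Fl}_{d_1,d_2,d_3}(A)$ is the set of all filtrations $0=V_0\subseteq V_1\subseteq V_2\subseteq V_3=V$ by $A$-subspaces with $\dim_A V_i/V_{i-1}=d_i$ for $i=1,2,3$; it is a single $GL_n(A)$-orbit. The map $\rho$ sends an $\mathcal{O}$-submodule $M$ of $V$ to the filtration $0\subseteq\widetilde{M}\subseteq AM\subseteq V$. *)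

(* Defs.v *)
From HB Require Import structures.
From mathcomp Require Import all_boot all_order all_algebra.
From mathcomp Require Import all_classical topology.

Set Implicit Arguments.
Unset Strict Implicit.
Unset Printing Implicit Defensive.

Import GRing.Theory.
Local Open Scope classical_set_scope.
Local Open Scope ring_scope.

Record fps (K : fieldType) := Fps { fps_coef :> nat -> K }.

HB.instance Definition _ (K : fieldType) := gen_eqMixin (fps K).
HB.instance Definition _ (K : fieldType) := gen_choiceMixin (fps K).

Section PowerSeries.
Variable K : fieldType.
Implicit Types f g h : fps K.

Lemma fpsP f g : (forall i, f i = g i) -> f = g.
Proof. by case: f g => [f] [g] /= /funext ->. Qed.

Definition fps0 : fps K := Fps (fun=> 0).
Definition fps_opp f : fps K := Fps (fun i => - f i).
Definition fps_add f g : fps K := Fps (fun i => f i + g i).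
Definition fps1 : fps K := Fps (fun i => (i == 0%N)%:R).
Definition fps_mul f g : fps K :=
  Fps (fun n => \sum_(i < n.+1) f i * g (n - i)%N).

Lemma fps_addA : associative fps_add.
Proof. by move=> f g h; apply: fpsP => i; rewrite /= addrA. Qed.
Lemma fps_addC : commutative fps_add.
Proof. by move=> f g; apply: fpsP => i; rewrite /= addrC. Qed.
Lemma fps_add0 : left_id fps0 fps_add.
Proof. by move=> f; apply: fpsP => i; rewrite /= add0r. Qed.
Lemma fps_addN : left_inverse fps0 fps_opp fps_add.
Proof. by move=> f; apply: fpsP => i; rewrite /= addNr. Qed.

HB.instance Definition _ :=
  GRing.isZmodule.Build (fps K) fps_addA fps_addC fps_add0 fps_addN.

Definition fps_trunc n f : {poly K} := \poly_(i < n) f i.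

Lemma coef_fps_mul n m f g : (m < n)%N ->
  fps_mul f g m = (fps_trunc n f * fps_trunc n g)`_m.
Proof.
move=> mn; rewrite coefM; apply: eq_bigr => i _.
by rewrite !coef_poly (leq_ltn_trans (leq_subr _ _) mn) (leq_trans (ltn_ord i) mn).
Qed.

Lemma fps_mulC : commutative fps_mul.
Proof.
by move=> f g; apply: fpsP => m; rewrite !(coef_fps_mul _ _ (ltnSn m)) mulrC.
Qed.

Lemma fps_mulA : associative fps_mul.
Proof.
move=> f g h; apply: fpsP => m.
set F := fps_trunc m.+1 f; set G := fps_trunc m.+1 g; set H := fps_trunc m.+1 h.
transitivity ((F * (G * H))`_m).
  rewrite /= coefM; apply: eq_bigr => i _.
  rewrite coef_poly ltn_ord; congr (_ * _).
  by rewrite -(@coef_fps_mul m.+1) // ltnS leq_subr.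
rewrite mulrA /= coefM; apply: eq_bigr => i _.
rewrite -(@coef_fps_mul m.+1) //; congr (_ * _).
by rewrite coef_poly ltnS leq_subr.
Qed.

Lemma fps_mul1 : left_id fps1 fps_mul.
Proof.
move=> f; apply: fpsP => m /=; rewrite big_ord_recl /= mul1r subn0.
by rewrite big1 ?addr0 // => i _; rewrite mul0r.
Qed.

Lemma fps_mulDl : left_distributive fps_mul +%R.
Proof.
move=> f g h; apply: fpsP => m /=; rewrite -big_split /=.
by apply: eq_bigr => i _; rewrite mulrDl.
Qed.

Lemma fps1_neq0 : fps1 != 0.
Proof.
apply/eqP => /(congr1 (fun f : fps K => f 0%N)) /= /eqP.
by rewrite oner_eq0.
Qed.

HB.instance Definition _ := GRing.Zmodule_isComNzRing.Build (fps K)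
  fps_mulA fps_mulC fps_mul1 fps_mulDl fps1_neq0.

Definition fps_unit : {pred fps K} := fun f => `[< exists g, g * f = 1 >].
Definition fps_inv f : fps K :=
  if fps_unit f then xget 0 [set g | g * f = 1] else f.

Lemma fps_mulVr : {in fps_unit, left_inverse 1 fps_inv *%R}.
Proof.
move=> f uf; rewrite /fps_inv; have -> : fps_unit f = true by [].
by move: uf => /asboolP [g gf]; case: xgetP => [h _ //|/(_ g)].
Qed.

Lemma fps_unitPl f g : g * f = 1 -> fps_unit f.
Proof. by move=> gf; apply/asboolP; exists g. Qed.

Lemma fps_inv_out : {in [predC fps_unit], fps_inv =1 id}.
Proof. move=> f; rewrite inE /fps_inv => nu.
by have -> : fps_unit f = false by apply/negbTE. Qed.

HB.instance Definition _ := GRing.ComNzRing_hasMulInverse.Build (fps K)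
  fps_mulVr fps_unitPl fps_inv_out.

Lemma fps_neq0_order f : f != 0 ->
  exists n, f n != 0 /\ forall i, (i < n)%N -> f i = 0.
Proof.
move=> f0; have ex : exists n, f n != 0.
  apply: contrapT => nex; move/eqP: f0; apply; apply: fpsP => i /=.
  by apply/eqP; apply: contrapT => /negP fi; apply: nex; exists i.
case: (ex_minnP ex) => n fn min; exists n; split=> // i lin.
by apply/eqP; apply: contraTT lin => /min; rewrite -leqNgt.
Qed.

Lemma fps_idomain : GRing.integral_domain_axiom (fps K).
Proof.
move=> f g fg0; apply: contrapT => /negP; rewrite negb_or => /andP[].
move=> /fps_neq0_order[a [fa fmin]] /fps_neq0_order[b [gb gmin]].
have /eqP := congr1 (fun h : fps K => h (a + b)%N) fg0.
have la : (a < (a + b).+1)%N by rewrite ltnS leq_addr.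
rewrite [X in X == _]/= (bigD1 (Ordinal la)) //= addKn big1 ?addr0.
  by rewrite mulf_eq0 (negbTE fa) (negbTE gb).
move=> i ia; have [lia|lai|eia] := ltngtP i a; first by rewrite fmin ?mul0r.
  rewrite gmin ?mulr0 // ltn_subLR ?ltn_add2r //.
  by rewrite -ltnS ltn_ord.
by move/eqP: ia; case; apply: val_inj.
Qed.

HB.instance Definition _ :=
  GRing.ComUnitRing_isIntegral.Build (fps K) fps_idomain.

Definition fpsX : fps K := Fps (fun i => (i == 1%N)%:R).

End PowerSeries.

Definition laurent (K : fieldType) : Type := {fraction fps K}.
HB.instance Definition _ (K : fieldType) := GRing.Field.on (laurent K).

Definition laurent_of_fps (K : fieldType) (a : fps K) : laurent K := tofrac a.

Section TAdicTopology.
Variable K : fieldType.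

Definition laurent_open : set_system (laurent K) :=
  [set U | forall x, U x -> exists m : nat,
     forall a : fps K, U (x + laurent_of_fps (fpsX K ^+ m * a))].

Lemma laurent_openT : laurent_open setT.
Proof. by move=> x _; exists 0%N. Qed.

Lemma laurent_openI : setI_closed laurent_open.
Proof.
move=> U W oU oW x [/oU[m Um] /oW[p Wp]]; exists (m + p)%N => a; split.
  by rewrite exprD -mulrA; apply: Um.
by rewrite addnC exprD -mulrA; apply: Wp.
Qed.

Lemma laurent_open_bigU (I : Type) (f : I -> set (laurent K)) :
  (forall i, laurent_open (f i)) -> laurent_open (\bigcup_i f i).
Proof.
by move=> of_ x [i _ /of_[m fm]]; exists m => a; exists i => //; apply: fm.
Qed.

HB.instance Definition _ := isOpenTopological.Build (laurent K)
  laurent_openT laurent_openI laurent_open_bigU.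

End TAdicTopology.

Definition GL (K : fieldType) (n : nat) : Type :=
  {g : 'M[laurent K]_n | g \in unitmx}.

HB.instance Definition _ K n := SubType.on (GL K n).
HB.instance Definition _ K n := [Choice of GL K n by <:].

Section GeneralLinear.
Variables (K : fieldType) (n : nat).
Implicit Types g h : GL K n.

Lemma GL_oneP : (1%:M : 'M[laurent K]_n) \in unitmx.
Proof. exact: unitmx1. Qed.
Lemma GL_mulP g h : val g *m val h \in unitmx.
Proof. by rewrite unitmx_mul (valP g) (valP h). Qed.
Lemma GL_invP g : invmx (val g) \in unitmx.
Proof. by rewrite unitmx_inv (valP g). Qed.

Definition GL_one : GL K n := exist (fun h : 'M[laurent K]_n => is_true (h \in unitmx)) _ GL_oneP.
Definition GL_mul g h : GL K n := exist (fun h : 'M[laurent K]_n => is_true (h \in unitmx)) _ (GL_mulP g h).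
Definition GL_inv g : GL K n := exist (fun h : 'M[laurent K]_n => is_true (h \in unitmx)) _ (GL_invP g).

Lemma GL_mulA : associative GL_mul.
Proof. by move=> f g h; apply: val_inj; apply: mulmxA. Qed.
Lemma GL_mul1 : left_id GL_one GL_mul.
Proof. by move=> g; apply: val_inj; apply: mul1mx. Qed.
Lemma GL_mulr1 : right_id GL_one GL_mul.
Proof. by move=> g; apply: val_inj; apply: mulmx1. Qed.
Lemma GL_mulV : left_inverse GL_one GL_inv GL_mul.
Proof. by move=> g; apply: val_inj; apply: mulVmx (valP g). Qed.
Lemma GL_mulrV : right_inverse GL_one GL_inv GL_mul.
Proof. by move=> g; apply: val_inj; apply: mulmxV (valP g). Qed.

HB.instance Definition _ := isGroup.Build (GL K n)
  GL_mulA GL_mul1 GL_mulr1 GL_mulV GL_mulrV.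

HB.instance Definition _ := Topological.copy (GL K n)
  (initial_topology (val : GL K n -> 'M[laurent K]_n)).

(* GL_n(k[[t]]) inside GL_n(k((t))). *)
Definition GLO : set (GL K n) :=
  [set g | exists2 h : 'M[fps K]_n,
             h \in unitmx & val g = map_mx (@laurent_of_fps K) h].

End GeneralLinear.

Section GroupActions.
Variables (G : groupType) (X : Type) (act : G -> X -> X).

Definition act_orbit (x : X) : set X := [set act g x | g in [set: G]].
Definition act_stab (x : X) : set G := [set g | act g x = x].

End GroupActions.

Definition ltranslate (G : groupType) (g : G) (C : set G) : set G :=
  [set (g * c)%g | c in C].

(* G / H as the set of left cosets gH; G acts on it by [ltranslate]. *)
Definition lcosets_of (G : groupType) (H : set G) : set (set G) :=
  [set ltranslate g H | g in [set: G]].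

Definition isomorphic_Gsets (G X Y : Type) (actX : G -> X -> X)
    (actY : G -> Y -> Y) (A : set X) (B : set Y) : Prop :=
  exists2 f : X -> Y,
    set_bij A B f & forall g x, A x -> f (actX g x) = actY g (f x).

(* X with the finest topology making all orbit maps g |-> g x continuous: every
   orbit is open and closed, and carries the quotient topology of G / G_x.
   Equivariant bijections are therefore homeomorphisms. *)
Definition orbit_space (G X : Type) (act : G -> X -> X) : Type := X.

HB.instance Definition _ (G X : Type) (act : G -> X -> X) :=
  gen_eqMixin (orbit_space act).
HB.instance Definition _ (G X : Type) (act : G -> X -> X) :=
  gen_choiceMixin (orbit_space act).

Section OrbitTopology.
Variables (G : topologicalType) (X : Type) (act : G -> X -> X).

Definition orbit_open : set_system (orbit_space act) :=
  [set U | forall x : X, open [set g | U (act g x)]].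

Lemma orbit_openT : orbit_open setT.
Proof. by move=> x; exact: openT. Qed.

Lemma orbit_openI : setI_closed orbit_open.
Proof. by move=> U W oU oW x; exact: (openI (oU x) (oW x)). Qed.

Lemma orbit_open_bigU (I : Type) (f : I -> set (orbit_space act)) :
  (forall i, orbit_open (f i)) -> orbit_open (\bigcup_i f i).
Proof.
move=> of_ x.
exact: (@bigcup_open _ _ setT (fun i => [set g | f i (act g x)]) (fun i _ => of_ i x)).
Qed.

HB.instance Definition _ := isOpenTopological.Build (orbit_space act)
  orbit_openT orbit_openI orbit_open_bigU.

End OrbitTopology.

Definition homeomorphism_on (X Y : topologicalType) (A : set X) (B : set Y)
    (f : X -> Y) : Prop :=
  [/\ set_bij A B f, {within A, continuous f} &
      exists2 g : Y -> X, {in A, cancel f g} & {within B, continuous g}].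

Definition fibre_bundle (X Y Z : topologicalType) (E : set X) (B : set Y)
    (F : set Z) (p : X -> Y) : Prop :=
  [/\ p @` E = B, {within E, continuous p} &
      forall b, B b -> exists U : set Y, [/\ open U, U b &
        exists phi : X -> Z,
          homeomorphism_on (E `&` p @^-1` U) ((B `&` U) `*` F)
            (fun x => (p x, phi x))]].

Section Span.
Variables (A : fieldType) (V : vectType A).

Lemma span_set_subproof (S : set V) : exists U : {vspace V},
  (forall x, S x -> x \in U) /\
  exists2 s : seq V, (forall x, x \in s -> S x) & U = <<s>>%VS.
Proof.
pose P d := `[< exists s : seq V, (forall x, x \in s -> S x) /\ \dim <<s>> = d >].
have exP : exists d, P d.
  by exists (\dim <<[::] : seq V>>); apply/asboolP; exists [::].
have ubP d : P d -> (d <= \dim {:V})%N.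
  by move=> /asboolP[s [_ <-]]; apply: dimvS (subvf _).
case: (ex_maxnP exP ubP) => d /asboolP[s [sS ds]] max.
exists <<s>>%VS; split=> [x Sx|]; last by exists s.
have le : (<<s>> <= <<x :: s>>)%VS by rewrite span_cons addvSr.
suff /eqP -> : <<s>>%VS == <<x :: s>>%VS by rewrite memv_span ?mem_head.
rewrite eqEdim le ds; apply: max; apply/asboolP; exists (x :: s); split=> // y.
by rewrite inE => /orP[/eqP -> //|/sS].
Qed.

Definition span_set (S : set V) : {vspace V} := projT1 (cid (span_set_subproof S)).

Lemma span_set_sub (S : set V) x : S x -> x \in span_set S.
Proof. by rewrite /span_set; case: cid => U /= [+ _]; apply. Qed.

Lemma span_set_min (S : set V) (W : {vspace V}) :
  (forall x, S x -> x \in W) -> (span_set S <= W)%VS.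
Proof.
rewrite /span_set; case: cid => U /= [_ [s sS ->]] SW.
by apply/span_subvP => x /sS /SW.
Qed.

Lemma mem_span_set (S : set V) x : S 0 ->
  (forall (a : A) y z, S y -> S z -> S (a *: y + z)) ->
  x \in span_set S <-> S x.
Proof.
move=> S0 SD; split=> [|Sx]; last exact: span_set_sub.
rewrite /span_set; case: cid => U /= [_ [s sS ->]] {U}.
elim: s sS x => [|y s IH] sS x; first by rewrite span_nil memv0 => /eqP ->.
rewrite span_cons => /memv_addP[_ /vlineP[a ->] [w ws ->]].
apply: SD; first by apply: sS; rewrite mem_head.
by apply: IH ws => u us; apply: sS; rewrite inE us orbT.
Qed.

End Span.

Section Submodules.
Variables (K : fieldType) (n : nat).
Local Notation V := 'cV[laurent K]_n.

Definition is_submodule (M : set V) : Prop :=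
  [/\ M 0, forall x y, M x -> M y -> M (x + y) &
      forall (a : fps K) x, M x -> M (laurent_of_fps a *: x)].

Definition act_sub (g : GL K n) (M : set V) : set V :=
  (fun x => val g *m x) @` M.

Definition tilde (M : set V) : set V :=
  [set x | M x /\ forall a : laurent K, M (a *: x)].

(* For a submodule M, [tilde M] is already an A-subspace: see [mem_core]. *)
Definition core (M : set V) : {vspace V} := span_set (tilde M).

Lemma mem_core M x : is_submodule M -> x \in core M <-> tilde M x.
Proof.
case=> M0 MD MZ; apply: mem_span_set.
  by split=> // a; rewrite scaler0.
move=> a y z [My Ly] [Mz Lz]; split=> [|b]; first exact: MD.
by rewrite scalerDr scalerA; apply: MD.
Qed.

(* The truncated subtractions in [flag_variety] are exact because F.1 <= F.2 <= A^n.
   The filtration 0 <= V_1 <= V_2 <= A^n is encoded as the pair (V_1, V_2). *)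
Definition flag : Type := ({vspace V} * {vspace V})%type.

Definition act_flag (g : GL K n) (F : flag) : flag :=
  ((linfun (mulmx (val g)) @: F.1)%VS, (linfun (mulmx (val g)) @: F.2)%VS).

Definition flag_variety (d1 d2 d3 : nat) : set flag :=
  [set F | [/\ (F.1 <= F.2)%VS, \dim F.1 = d1, (\dim F.2 - \dim F.1)%N = d2 &
               (n - \dim F.2)%N = d3]].

Definition rho (M : set V) : flag := (core M, span_set M).

End Submodules.

Arguments act_sub : clear implicits.
Arguments act_flag : clear implicits.
Arguments GLO : clear implicits.
Arguments flag_variety : clear implicits.

Notation submodule_space K n := (orbit_space (act_sub K n)).
Notation flag_space K n := (orbit_space (act_flag K n)).
Notation coset_space K r := (orbit_space (@ltranslate (GL K r))).

Definition affine_grassmannian (K : fieldType) (r : nat) : set (set (GL K r)) :=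
  lcosets_of (GLO K r).

Arguments affine_grassmannian : clear implicits.

(* Main.v *)
Require Import Defs.
From HB Require Import structures.
From mathcomp Require Import all_boot all_order all_algebra.
From mathcomp Require Import all_classical topology.

Set Implicit Arguments.
Unset Strict Implicit.
Unset Printing Implicit Defensive.

Import GRing.Theory.
Local Open Scope classical_set_scope.
Local Open Scope ring_scope.

(** Write [A] for the Laurent series and [O] for the power series over [K].

    Everything rests on a normal form for submodules: an [O]-submodule [M] of
    [A^n] is, in a suitable [A]-basis of [A^n], the sum of [k] copies of [A]
    and [r] copies of [O] ([submodule_basis]).  This goes by induction on the
    number of nonzero coordinates.  The values of one coordinate on [M] form an
    [O]-submodule of [A], hence 0, a cyclic module, or all of [A].  In the
    cyclic case one lifts a generator; when the values fill [A], completeness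
    of [O] lets one correct a compatible family of lifts of the [t^-m] so that
    a whole line [A y] lies in [M] ([lift_line]).

    From the normal form, [core M] and [span_set M] are the spans of the first
    [k] and the first [k + r] basis vectors.  So every flag [F] of type
    [(k, r, l)] carries a basis adapted to it, and with it a point of the orbit
    over [F].  The submodules in the orbit that lie over [F] are the
    [lattice_at fr h], the preimages in [F.2] of the lattices [h O^r] in
    [F.2 / F.1]; since the stabiliser of [O^r] is [GL_r(O)], they correspond to
    the cosets of [GL_r(O)] in [GL_r(A)], and the stabiliser of [F] acts on them
    through its action on [F.2 / F.1] ([act_lattice_at]).

    For local triviality, a choice of complements of [F.1] and [F.2] turns each
    subspace transverse to the complement into the graph of a linear map, and
    this gives a section of [g |-> g F] over the open set of flags transverse
    to the complements ([cell_section]).  It is a rational function of the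
    matrix [g], hence continuous.  Translating by the section identifies the
    part of the orbit over the cell with the product of the cell and the fibre.

    The topologies enter through one fact: for the finest topology making all
    orbit maps continuous, the neighbourhoods of [x] are the sets that contain
    [g x] for all [g] near 1 ([nbhs_orbitP]).  Every continuity statement then
    becomes a limit of matrices at [g = 1], where limits are measured by
    divisibility by powers of [t] ([mxlim]). *)

(** * Power series and Laurent series *)

Section PowerSeriesUnits.
Variable K : fieldType.
Implicit Types (f g u : fps K) (c d : nat -> fps K).

Lemma fpsED f g i : (f + g) i = f i + g i. Proof. by []. Qed.
Lemma fpsE1 i : (1 : fps K) i = (i == 0%N)%:R. Proof. by []. Qed.

Lemma fpsXM0 f : (fpsX K * f) 0%N = 0.
Proof. by rewrite /= big_ord1 /= mul0r. Qed.

Lemma fpsXMS f i : (fpsX K * f) i.+1 = f i.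
Proof.
rewrite /= (bigD1 (Ordinal (isT : (1 < i.+2)%N))) //= subSS subn0 mul1r.
rewrite big1 ?addr0 // => -[[|[|j]] jlt] //= _; by rewrite mul0r.
Qed.

Lemma fpsX_neq0 : fpsX K != 0.
Proof.
apply/eqP => /(congr1 (fun f : fps K => f 1%N)) /eqP.
by rewrite /= oner_eq0.
Qed.

(** The t-adically convergent sum of the [t^i c_i]; the coefficient of [t^m]
    only involves the terms with [i <= m]. *)
Definition fps_series c : fps K :=
  Fps (fun m => \sum_(i < m.+1) c i (m - i)%N).

Lemma fps_seriesS c :
  fps_series c = c 0%N + fpsX K * fps_series (fun i => c i.+1).
Proof.
apply: fpsP => -[|m]; first by rewrite fpsED fpsXM0 addr0 /= big_ord1.
rewrite fpsED fpsXMS /= big_ord_recl subn0; congr (_ + _).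
Qed.

Lemma fps_series_split c j : fps_series c =
  \sum_(i < j) fpsX K ^+ i * c i + fpsX K ^+ j * fps_series (fun i => c (j + i)%N).
Proof.
elim: j => [|j IH]; first by rewrite big_ord0 add0r expr0 mul1r.
rewrite IH big_ord_recr /= -addrA; congr (_ + _).
rewrite (fps_seriesS (fun i => _)) addn0 mulrDr mulrA -exprSr.
by under [in RHS]eq_fun do rewrite addSnnS.
Qed.

(** The difference [D c] of the two sides satisfies [D c = t D (shift c)], so
    it is divisible by every power of [t]. *)
Lemma fps_seriesZ u c : fps_series (fun i => u * c i) = u * fps_series c.
Proof.
pose D c := fps_series (fun i => u * c i) - u * fps_series c.
have DS d : D d = fpsX K * D (fun i => d i.+1).
  rewrite /D (fps_seriesS d) (fps_seriesS (fun i => u * d i)) mulrDr mulrBr.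
  by rewrite opprD addrACA subrr add0r (mulrCA u).
have D0 : D c = 0.
  apply: fpsP => i; elim: i c => [|i IH] d; rewrite DS; first exact: fpsXM0.
  by rewrite fpsXMS IH.
by apply/eqP; rewrite -subr_eq0; apply/eqP.
Qed.

(** After scaling, [f = 1 - t w], and its inverse is the geometric series
    in [t w]. *)
Lemma fps_unitP f : f 0%N != 0 -> f \is a GRing.unit.
Proof.
move=> f0; pose v : fps K := Fps (fun i => f i.+1).
pose C (a : K) : fps K := Fps (fun i => if i is 0%N then a else 0).
have CM a g i : (C a * g) i = a * g i.
  rewrite /= big_ord_recl subn0 big1 ?addr0 // => j _ /=.
  by rewrite mul0r.
have fE : C (f 0%N)^-1 * f = 1 - fpsX K * (- C (f 0%N)^-1 * v).
  apply: fpsP => -[|i]; rewrite CM mulNr mulrN opprK fpsED fpsE1.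
    by rewrite fpsXM0 mulVf // addr0.
  by rewrite fpsXMS CM add0r.
set w := - _ * v in fE.
have := fps_seriesS (fun i => w ^+ i).
rewrite (_ : (fun i => w ^+ i.+1) = (fun i => w * w ^+ i)); last first.
  by apply/funext => i; rewrite exprS.
rewrite fps_seriesZ mulrA expr0; set S := fps_series _ => E.
apply/unitrPr; exists (C (f 0%N)^-1 * S).
by rewrite mulrA [f * _]mulrC fE mulrBl mul1r {1}E addrK.
Qed.

Lemma fps_coef0_is_zmod_morphism : zmod_morphism (fun f => f 0%N).
Proof. by []. Qed.

Lemma fps_coef0_is_monoid_morphism : monoid_morphism (fun f => f 0%N).
Proof. by split=> // f g; rewrite /= big_ord1. Qed.

Definition fps_coef0 f := f 0%N.
HB.instance Definition _ :=
  GRing.isZmodMorphism.Build (fps K) K fps_coef0 fps_coef0_is_zmod_morphism.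
HB.instance Definition _ :=
  GRing.isMonoidMorphism.Build (fps K) K fps_coef0 fps_coef0_is_monoid_morphism.

(** The ring of power series is a discrete valuation ring with
    uniformiser [t]. *)
Lemma fps_neq0_decomp f : f != 0 ->
  exists e u, u \is a GRing.unit /\ f = fpsX K ^+ e * u.
Proof.
case/fps_neq0_order => e [fe fmin]; exists e, (Fps (fun i => f (e + i)%N)).
split; first by apply: fps_unitP; rewrite /= addn0.
elim: e f fmin {fe} => [|e IH] f fmin.
  by rewrite expr0 mul1r; apply: fpsP.
have fE : f = fpsX K * Fps (fun i => f i.+1).
  by apply: fpsP => -[|i]; rewrite ?fpsXM0 ?fpsXMS // fmin.
rewrite [LHS]fE (IH (Fps _)) /= ?exprS ?mulrA //.
by move=> i ie; apply: fmin.
Qed.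

End PowerSeriesUnits.

HB.instance Definition _ (K : fieldType) := GRing.RMorphism.copy
  (@laurent_of_fps K) (@tofrac (fps K)).

Section Laurent.
Variable K : fieldType.
Local Notation A := (laurent K).
Local Notation iota := (@laurent_of_fps K).

Definition laurentX : A := iota (fpsX K).

Lemma laurent_of_fps_inj : injective iota.
Proof. by move=> f g /eqP; rewrite /laurent_of_fps tofrac_eq => /eqP. Qed.

Lemma iota_eq0 f : (iota f == 0) = (f == 0).
Proof. by rewrite -(rmorph0 iota) (inj_eq laurent_of_fps_inj). Qed.

Lemma laurentX_neq0 : laurentX != 0.
Proof. by rewrite iota_eq0 fpsX_neq0. Qed.

Lemma laurentX_expf_neq0 m : laurentX ^+ m != 0.
Proof. by rewrite expf_neq0 ?laurentX_neq0. Qed.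

Lemma laurent_frac (x : A) : exists a b, b != 0 /\ x = iota a / iota b.
Proof.
suff [a [b [b0 E]]] : exists a b, b != 0 /\ iota b * x = iota a.
  by exists a, b; split=> //; rewrite -E mulrC mulKf // (iota_eq0).
elim/quotW: x => x; exists (frac x).1, (frac x).2; split; first exact: denom_ratioP.
rewrite /laurent_of_fps; unlock tofrac; rewrite -[LHS]FracField.pi_mul.
apply/eqmodP; rewrite /= FracField.equivfE /FracField.mulf.
rewrite !numden_Ratio ?mul1r ?oner_eq0 ?denom_ratioP //.
by rewrite mulr1 mulrC.
Qed.

Lemma laurentP (x : A) : exists m a, x = iota a / laurentX ^+ m.
Proof.
have [a [b [/fps_neq0_decomp[e [u [uu ->]]] ->]]] := laurent_frac x.
exists e, (a * u^-1); rewrite [iota (_ * u)]rmorphM rmorphXn rmorphM rmorphV //.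
by rewrite -/laurentX invfM -mulrA [_^-1 / _]mulrC.
Qed.

Lemma laurent_neq0P (x : A) : x != 0 ->
  exists m e u, u \is a GRing.unit /\ x = laurentX ^+ e * iota u / laurentX ^+ m.
Proof.
have [m [a ->]] := laurentP x => x0.
have a0 : a != 0 by apply: contraNneq x0 => ->; rewrite rmorph0 mul0r.
have [e [u [uu ->]]] := fps_neq0_decomp a0.
by exists m, e, u; rewrite rmorphM rmorphXn.
Qed.

End Laurent.

(** * Limits of matrices for the t-adic topology *)

Section AdicMatrices.
Variable K : fieldType.
Local Notation A := (laurent K).
Local Notation O := (fps K).
Local Notation iota := (@laurent_of_fps K).
Local Notation t := (laurentX K).

(** [Y] is divisible by [t^m] in the integral matrices; as [m] varies these
    are the basic neighbourhoods of 0. *)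
Definition adic_small m p q (Y : 'M[A]_(p, q)) : Prop :=
  exists Z : 'M[O]_(p, q), Y = t ^+ m *: map_mx iota Z.

Lemma adic_small0 m p q : adic_small m (0 : 'M[A]_(p, q)).
Proof. by exists 0; rewrite map_mx0 scaler0. Qed.

Lemma adic_smallD m p q (Y Y' : 'M[A]_(p, q)) :
  adic_small m Y -> adic_small m Y' -> adic_small m (Y + Y').
Proof. by move=> [Z ->] [Z' ->]; exists (Z + Z'); rewrite map_mxD scalerDr. Qed.

Lemma adic_small_le a b p q (Y : 'M[A]_(p, q)) :
  (a <= b)%N -> adic_small b Y -> adic_small a Y.
Proof.
move=> ab [Z ->]; exists (fpsX K ^+ (b - a) *: Z).
by rewrite map_mxZ /= rmorphXn scalerA -exprD subnKC.
Qed.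

Lemma adic_smallM a b p q s (X : 'M[A]_(p, q)) (Y : 'M[A]_(q, s)) :
  adic_small a X -> adic_small b Y -> adic_small (a + b) (X *m Y).
Proof.
move=> [Z ->] [Z' ->]; exists (Z *m Z').
by rewrite map_mxM -scalemxAl -scalemxAr scalerA exprD.
Qed.

Lemma mx_clear_denominator p q (Y : 'M[A]_(p, q)) :
  exists d, adic_small 0 (t ^+ d *: Y).
Proof.
have /choice[m mP] : forall ij : 'I_p * 'I_q, exists m, exists a,
    t ^+ m * Y ij.1 ij.2 = iota a.
  move=> ij; have [m [a ->]] := laurentP (Y ij.1 ij.2).
  by exists m, a; rewrite mulrC divfK ?laurentX_expf_neq0.
pose d := (\max_ij m ij)%N.
have /choice[z zP] ij : exists a, t ^+ d * Y ij.1 ij.2 = iota a.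
  have [a aE] := mP ij; exists (fpsX K ^+ (d - m ij) * a).
  rewrite rmorphM rmorphXn /= -aE mulrA -exprD subnK //.
  by rewrite /d (bigD1 ij) //= leq_maxl.
exists d, (\matrix_(i, j) z (i, j)); apply/matrixP => i j.
by rewrite !mxE expr0 mul1r -zP.
Qed.

(** Right multiplication by [Y] loses at most the power of [t] occurring in
    a denominator of [Y]. *)
Lemma adic_smallMr p q s (Y : 'M[A]_(q, s)) : exists d, forall m (X : 'M[A]_(p, q)),
  adic_small (m + d) X -> adic_small m (X *m Y).
Proof.
have [d [Z ZE]] := mx_clear_denominator Y; exists d => m _ [X ->].
exists (X *m Z); rewrite map_mxM exprD -scalerA -scalemxAl -scalemxAl.
by rewrite scalemxAr ZE expr0 scale1r.
Qed.

Lemma adic_smallMl p q s (X : 'M[A]_(p, q)) : exists d, forall m (Y : 'M[A]_(q, s)),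
  adic_small (m + d) Y -> adic_small m (X *m Y).
Proof.
have [d [Z ZE]] := mx_clear_denominator X; exists d => m _ [Y ->].
exists (Z *m Y); rewrite map_mxM exprD -scalerA -!scalemxAr.
by rewrite scalemxAl ZE expr0 scale1r.
Qed.

(** A matrix congruent to 1 modulo [t] is integral with determinant of
    constant coefficient 1, so its inverse is integral too, and
    [N^-1 - 1 = - (N - 1) N^-1] is as small as [N - 1]. *)
Lemma unitmx_near1 m p (Y : 'M[A]_p) : adic_small m.+1 (Y - 1%:M) ->
  Y \in unitmx /\ adic_small m.+1 (invmx Y - 1%:M).
Proof.
case=> Z YE; pose N := 1%:M + fpsX K ^+ m.+1 *: Z.
have NY : Y = map_mx iota N.
  by rewrite map_mxD map_mx1 map_mxZ /= rmorphXn -YE addrC subrK.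
(* The constant coefficient is a ring morphism, so it commutes with [\det]. *)
have Nu : N \in unitmx.
  rewrite unitmxE; apply: fps_unitP; rewrite -/(fps_coef0 (\det N)) -det_map_mx.
  suff -> : map_mx (@fps_coef0 K) N = 1%:M by rewrite det1 oner_neq0.
  apply/matrixP => i j; rewrite !mxE rmorphD exprS -mulrA.
  rewrite [X in _ + X]fpsXM0 addr0; by case: (i == j); rewrite ?rmorph1 ?rmorph0.
have NV : Y *m map_mx iota (invmx N) = 1%:M by rewrite NY -map_mxM mulmxV // map_mx1.
have [Yu _] := mulmx1_unit NV; split=> //.
have -> : invmx Y = map_mx iota (invmx N) by rewrite -[RHS](mulKmx Yu) NV mulmx1.
exists (- Z *m invmx N); apply: (can_inj (mulKmx Yu)).
rewrite mulmxBr NV mulmx1 -[1%:M - Y]opprB YE map_mxM map_mxN mulNmx scalerN mulmxN.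
congr (- _); rewrite -scalemxAr; congr (_ *: _); rewrite NY -!map_mxM; congr map_mx.
suff E : comm_mx N Z by rewrite mulmxA E -mulmxA mulmxV // mulmx1.
by rewrite /comm_mx mulmxDl mulmxDr mul1mx mulmx1 -scalemxAl -scalemxAr.
Qed.

(** Convergence along [F] stated by t-adic estimates.  For entries in [A]
    it is the convergence of the product topology ([nbhs_mxP]), and it applies
    to rectangular matrices that are values of algebraic expressions. *)
Definition mxlim T (F : set_system T) p q (f : T -> 'M[A]_(p, q))
    (X : 'M[A]_(p, q)) : Prop :=
  forall m, \forall x \near F, adic_small m (f x - X).

Section MxLim.
Variables (T : Type) (F : set_system T).
Context {FF : Filter F}.

Lemma mxlim_cst p q (X : 'M[A]_(p, q)) : mxlim F (fun=> X) X.
Proof. by move=> m; apply: nearW => x; rewrite subrr; apply: adic_small0. Qed.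

Lemma mxlimD p q (f g : T -> 'M[A]_(p, q)) X Y :
  mxlim F f X -> mxlim F g Y -> mxlim F (fun x => f x + g x) (X + Y).
Proof.
move=> fX gY m; apply: filterS2 (fX m) (gY m) => x fx gx.
by rewrite opprD addrACA; apply: adic_smallD.
Qed.

Lemma mxlimM p q s (f : T -> 'M[A]_(p, q)) (g : T -> 'M[A]_(q, s)) X Y :
  mxlim F f X -> mxlim F g Y -> mxlim F (fun x => f x *m g x) (X *m Y).
Proof.
move=> fX gY m; have [d dP] := adic_smallMr p Y; have [e eP] := adic_smallMl s X.
apply: filterS3 (fX (m + d)%N) (gY (m + e)%N) (gY 0%N) => x fx gx gx0.
have -> : f x *m g x - X *m Y =
    (f x - X) *m (g x - Y) + ((f x - X) *m Y + X *m (g x - Y)).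
  rewrite mulmxBr addrA subrK [X *m (g x - Y)]mulmxBr addrA; congr (_ - _).
  by rewrite mulmxBl subrK.
apply: adic_smallD; last by apply: adic_smallD; [apply: dP | apply: eP].
by rewrite -[m]addn0; apply: adic_smallM gx0; apply: adic_small_le fx; rewrite leq_addr.
Qed.

Lemma mxlim_unit p (f : T -> 'M[A]_p) X : X \in unitmx ->
  mxlim F f X -> \forall x \near F, f x \in unitmx.
Proof.
move=> Xu fX; have := mxlimM (mxlim_cst (invmx X)) fX => /(_ 1%N).
rewrite (mulVmx Xu); apply: filterS => x /unitmx_near1[].
by rewrite unitmx_mul => /andP[].
Qed.

(** By translation the inverse need only be continuous at 1, which is
    [unitmx_near1]. *)
Lemma mxlimV p (f : T -> 'M[A]_p) X : X \in unitmx ->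
  mxlim F f X -> mxlim F (fun x => invmx (f x)) (invmx X).
Proof.
move=> Xu fX; have fX1 := mxlimM (mxlim_cst (invmx X)) fX.
have fV : mxlim F (fun x => invmx (invmx X *m f x)) 1%:M.
  move=> m; have := fX1 m.+1; rewrite (mulVmx Xu); apply: filterS => x.
  by case/unitmx_near1 => _; apply: adic_small_le.
move=> m; have := mxlimM fV (mxlim_cst (invmx X)) => /(_ m).
rewrite mul1mx; apply: filterS2 (mxlim_unit Xu fX) => x xu.
suff -> : invmx (invmx X *m f x) *m invmx X = invmx (f x) by [].
apply: (can_inj (mulKmx xu)); rewrite (mulmxV xu).
apply: (can_inj (mulKmx (_ : invmx X \in unitmx))); first by rewrite unitmx_inv.
have Yu : invmx X *m f x \in unitmx by rewrite unitmx_mul unitmx_inv Xu.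
by rewrite !mulmxA (mulmxV Yu) mul1mx mulmx1.
Qed.

Lemma mxlim_comp T' (F' : set_system T') (h : T' -> T) p q (f : T -> 'M[A]_(p, q)) X :
  h @ F' --> F -> mxlim F f X -> mxlim F' (f \o h) X.
Proof. by move=> hF fX m; apply: hF (fX m). Qed.

End MxLim.

Lemma nbhs_laurentP (x : A) (W : set A) :
  nbhs x W <-> exists m, forall a : O, W (x + iota (fpsX K ^+ m * a)).
Proof.
split=> [[B [oB Bx BW]]|[m mW]].
  by have [m mB] := oB _ Bx; exists m => a; apply: BW.
exists [set x + iota (fpsX K ^+ m * a) | a in setT]; split.
- move=> _ [a _ <-]; exists m => b; exists (a + b) => //.
  by rewrite mulrDr rmorphD addrA.
- by exists 0 => //; rewrite mulr0 rmorph0 addr0.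
- by move=> _ [a _ <-].
Qed.

Lemma nbhs_mxP p q (X : 'M[A]_(p, q)) (W : set 'M[A]_(p, q)) :
  nbhs X W <-> exists m, forall Y, adic_small m (Y - X) -> W Y.
Proof.
split=> [[P XP PW]|[m mW]].
  have /choice[m mP] : forall ij : 'I_p * 'I_q, exists m, forall a : O,
      P ij.1 ij.2 (X ij.1 ij.2 + iota (fpsX K ^+ m * a)).
    by move=> ij; apply/nbhs_laurentP/XP.
  exists (\max_ij m ij)%N => Y [Z YX]; apply: PW => i j.
  have le : (m (i, j) <= \max_ij m ij)%N by rewrite (bigD1 (i, j)) //= leq_maxl.
  have := mP (i, j) (fpsX K ^+ ((\max_ij m ij) - m (i, j)) * Z i j).
  rewrite mulrA -exprD subnKC //= rmorphM rmorphXn.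
  move/matrixP: YX => /(_ i j); rewrite !mxE => <-.
  by rewrite [X i j + _]addrC subrK.
exists (fun i j => [set y | exists a, y = X i j + iota (fpsX K ^+ m * a)]).
  by move=> i j; apply/nbhs_laurentP; exists m => a; exists a.
move=> Y /= YX; apply: mW.
have /choice[z zP] : forall ij : 'I_p * 'I_q, exists a : O,
    Y ij.1 ij.2 = X ij.1 ij.2 + iota (fpsX K ^+ m * a) by move=> ij; apply: YX.
exists (\matrix_(i, j) z (i, j)); apply/matrixP => i j.
by rewrite !mxE (zP (i, j)) /= addrC addKr rmorphM rmorphXn.
Qed.

Lemma nbhs_GLP p (g : GL K p) (W : set (GL K p)) :
  nbhs g W <-> exists m, forall h, adic_small m (val h - val g) -> W h.
Proof.
split=> [|[m mW]].
  rewrite nbhsE => -[B [[C oC <-] gC] BW].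
  have /nbhs_mxP[m mC] : nbhs (val g) C by apply: open_nbhs_nbhs.
  by exists m => h /mC Ch; apply: BW.
have : nbhs (val g) [set Y | adic_small m (Y - val g)] by apply/nbhs_mxP; exists m.
rewrite nbhsE => -[C [oC gC] CW].
rewrite nbhsE; exists (val @^-1` C); first by split=> //; exists C.
by move=> h /CW /mW.
Qed.

Lemma cvg_GLP T (F : set_system T) {FF : Filter F} p (f : T -> GL K p)
    (g : GL K p) :
  f @ F --> g <-> mxlim F (fun x => val (f x)) (val g).
Proof.
split=> [fg m|fg W /nbhs_GLP[m mW]].
  by apply: (fg [set h | adic_small m (val h - val g)]); apply/nbhs_GLP; exists m.
by apply: filterS (fg m) => x /mW.
Qed.

Lemma mxlim_val p (g : GL K p) : mxlim (nbhs g) (fun h => val h) (val g).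
Proof. exact/cvg_GLP/cvg_id. Qed.

Lemma GL_mulr_continuous p (h : GL K p) : continuous (fun g : GL K p => (g * h)%g : GL K p).
Proof.
move=> g; apply/(cvg_GLP (FF := nbhs_filter g)).
exact: mxlimM (mxlim_val g) (mxlim_cst (val h)).
Qed.

End AdicMatrices.

(** * Group actions and the orbit topology *)

Lemma ltranslate1 (G : groupType) (C : set G) : ltranslate 1%g C = C.
Proof.
by apply/seteqP; split=> [_ [c Cc <-]|c Cc]; rewrite ?mul1g //; exists c; rewrite ?mul1g.
Qed.

Lemma ltranslateM (G : groupType) (g h : G) (C : set G) :
  ltranslate (g * h)%g C = ltranslate g (ltranslate h C).
Proof.
apply/seteqP; split=> [_ [c Cc <-]|_ [_ [c Cc <-] <-]].
  by exists (h * c)%g; [exists c | rewrite mulgA].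
by exists c => //; rewrite mulgA.
Qed.

Section OrbitStabiliser.
Variables (G : groupType) (X : Type) (act : G -> X -> X).
Hypothesis act1 : forall x, act 1%g x = x.
Hypothesis actM : forall g h x, act (g * h)%g x = act g (act h x).

Lemma actK g : cancel (act g) (act g^-1%g).
Proof. by move=> x; rewrite -actM mulVg act1. Qed.

Lemma actKV g : cancel (act g^-1%g) (act g).
Proof. by move=> x; rewrite -actM mulgV act1. Qed.

Lemma act_stabM x g h :
  act_stab act x g -> act_stab act x h -> act_stab act x (g * h)%g.
Proof. by rewrite /act_stab /= actM => gx ->. Qed.

Lemma act_stabV x g : act_stab act x g -> act_stab act x g^-1%g.
Proof. by rewrite /act_stab /= => {1}<-; rewrite actK. Qed.

Lemma act_orbit_act x y g : act_orbit act x y -> act_orbit act x (act g y).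
Proof. by move=> [h _ <-]; exists (g * h)%g => //; rewrite actM. Qed.

Lemma act_orbit_eq x y : act_orbit act x y -> act_orbit act y = act_orbit act x.
Proof.
move=> xy; apply/seteqP; split=> _ [g _ <-]; first exact: act_orbit_act.
by move: xy => [h _ <-]; exists (g * h^-1)%g => //; rewrite actM actK.
Qed.

Lemma orbit_stabiliser x :
  isomorphic_Gsets (@ltranslate G) act (lcosets_of (act_stab act x)) (act_orbit act x).
Proof.
pose f (C : set G) := act (xget 1%g C) x.
have fE g : f (ltranslate g (act_stab act x)) = act g x.
  rewrite /f; case: xgetP => [h _ [s /= sx <-]|/(_ g)]; first by rewrite actM sx.
  by case; exists 1%g; [exact: act1 | rewrite mulg1].
exists f; last by move=> g _ [h _ <-]; rewrite -ltranslateM !fE actM.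
split.
- by move=> _ [g _ <-]; rewrite fE; exists g.
- move=> _ _ /set_mem[g _ <-] /set_mem[h _ <-]; rewrite !fE => gh.
  have hg : act_stab act x (h^-1 * g)%g by rewrite /act_stab /= actM gh actK.
  apply/seteqP; split=> _ [s sx <-].
    exists (h^-1 * g * s)%g; first exact: act_stabM.
    by rewrite !mulgA mulgV mul1g.
  exists ((h^-1 * g)^-1 * s)%g; first by apply: act_stabM sx; apply: act_stabV.
  have {1}-> : g = (h * (h^-1 * g))%g by rewrite mulgA mulgV mul1g.
  by rewrite -!mulgA [(h^-1 * (g * _))%g]mulgA (mulgA (h^-1 * g)%g) mulgV mul1g.
- by move=> _ [g _ <-]; exists (ltranslate g (act_stab act x)); [exists g | exact: fE].
Qed.

End OrbitStabiliser.

Section OrbitTopologyTheory.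
Variables (K : fieldType) (p : nat) (X : Type) (act : GL K p -> X -> X).
Hypothesis act1 : forall x, act 1%g x = x.
Hypothesis actM : forall g h x, act (g * h)%g x = act g (act h x).

(** Orbit maps are continuous by definition of the topology; the converse
    says that they are open: the preimage of [N x] under another orbit map is
    a union of right translates of [N]. *)
Lemma nbhs_orbitP (x : orbit_space act) (W : set (orbit_space act)) :
  nbhs x W <-> nbhs (1%g : GL K p) [set g | W (act g x)].
Proof.
split=> [[B [oB Bx BW]]|].
  have : open_nbhs (1%g : GL K p) [set g | B (act g x)].
    by split; [exact: oB | rewrite /= act1].
  by move=> /open_nbhs_nbhs; apply: filterS => g; apply: BW.
rewrite nbhsE => -[N [oN N1] NW].
exists [set act g x | g in N]; split; last first.
- by move=> _ [g Ng <-]; apply: NW.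
- by exists 1%g => //; rewrite act1.
move=> y; rewrite openE => g [h Nh hx].
have gN : nbhs g [set g' : GL K p | N (g' * (g^-1 * h))%g].
  apply: (@GL_mulr_continuous K p (g^-1 * h)%g g N).
  by rewrite mulgA mulgV mul1g; apply: open_nbhs_nbhs.
apply: filterS gN => g' /= Ng'; exists (g' * (g^-1 * h))%g => //.
by rewrite !actM hx (actK act1 actM).
Qed.

Lemma act_orbit_open (x : X) : open (act_orbit act x : set (orbit_space act)).
Proof.
rewrite openE => y xy; apply/nbhs_orbitP; apply: filterE => g /=.
exact: act_orbit_act.
Qed.

End OrbitTopologyTheory.

(** * The normal form of a submodule of A^n *)

Section Structure.
Variables (K : fieldType) (n : nat).
Local Notation A := (laurent K).
Local Notation O := (fps K).
Local Notation iota := (@laurent_of_fps K).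
Local Notation t := (laurentX K).
Local Notation V := 'cV[A]_n.
Implicit Types (M : set V) (a b s : seq V) (x y z : V).

Lemma submoduleB M x y : is_submodule M -> M x -> M y -> M (x - y).
Proof.
case=> _ MD MZ Mx My; apply: MD => //.
by rewrite -scaleN1r -(rmorph1 iota) -rmorphN; apply: MZ.
Qed.

(** The [O]-linear combinations of [b], with the coefficients stored as a
    function on all indices so that the family can grow at the front. *)
Definition Ospan b : set V :=
  [set x | exists c : nat -> O, x = \sum_(i < size b) iota (c i) *: b`_i].

Lemma Ospan_mem b i : (i < size b)%N -> Ospan b b`_i.
Proof.
move=> ib; exists (fun j => (j == i)%:R); rewrite (bigD1 (Ordinal ib)) //= eqxx.
rewrite rmorph1 scale1r big1 ?addr0 // => j; rewrite -val_eqE /= => /negbTE ->.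
by rewrite rmorph0 scale0r.
Qed.

Lemma Ospan0 b : Ospan b 0.
Proof. by exists (fun=> 0); rewrite big1 // => i _; rewrite rmorph0 scale0r. Qed.

Lemma Ospan_cons y b x :
  Ospan (y :: b) x <-> exists (c : O) w, Ospan b w /\ x = iota c *: y + w.
Proof.
split=> [[c ->]|[c [_ [[e ->] ->]]]].
  rewrite big_ord_recl; exists (c 0%N), (\sum_(i < size b) iota (c i.+1) *: b`_i).
  by split=> //; exists (fun i => c i.+1).
exists (fun i => if i is i'.+1 then e i' else c).
by rewrite big_ord_recl.
Qed.

(** With [a ++ b] free, this is the normal form of [M]. *)
Definition spanned M a b : Prop :=
  forall x, M x <-> exists u w, [/\ u \in <<a>>%VS, Ospan b w & x = u + w].

Lemma spanned_span M a b u : spanned M a b -> u \in <<a>>%VS -> M u.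
Proof. by move=> Mab ua; apply/Mab; exists u, 0; split; rewrite ?addr0 //; apply: Ospan0. Qed.

Lemma spanned_Ospan M a b w : spanned M a b -> Ospan b w -> M w.
Proof. by move=> Mab wb; apply/Mab; exists 0, w; split; rewrite ?mem0v ?add0r. Qed.

Lemma spanned_mem M a b z : spanned M a b -> z \in a ++ b -> M z.
Proof.
move=> Mab; rewrite mem_cat => /orP[za|/(nthP 0)[i ib <-]].
  exact: (spanned_span Mab (memv_span za)).
exact: (spanned_Ospan Mab (Ospan_mem ib)).
Qed.

Lemma span_coord0 (j : 'I_n) s : (forall z, z \in s -> z j 0 = 0) ->
  forall x, x \in <<s>>%VS -> x j 0 = 0.
Proof.
move=> s0 x xs; rewrite (coord_span (X := in_tuple s) xs) summxE big1 // => i _.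
by rewrite mxE s0 ?mulr0 // mem_nth.
Qed.

Section Step.
Variables (M : set V) (j : 'I_n).
Hypothesis hM : is_submodule M.

Let M' : set V := [set x | M x /\ x j 0 = 0].

Lemma slice_submodule : is_submodule M'.
Proof.
case: hM => M0 MD MZ; split.
- by split; rewrite ?mxE.
- by move=> x y [Mx x0] [My y0]; split; [exact: MD | rewrite mxE x0 y0 addr0].
- by move=> c x [Mx x0]; split; [exact: MZ | rewrite mxE x0 mulr0].
Qed.

(** The [O]-submodules of [A] are 0, [A], and the cyclic ones.  If the
    values of the coordinate omit some [t^-m], then they are bounded by it, and
    a value of least order generates them all. *)
Lemma coordinate_ideal :
  [\/ forall x, M x -> x j 0 = 0,
      forall m, exists2 x, M x & x j 0 = t ^- m
    | exists y, [/\ M y, y j 0 != 0 &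
        forall x, M x -> exists c : O, x j 0 = iota c * y j 0]].
Proof.
have [?|/existsNP[x0 /not_implyP[Mx0 /eqP x00]]] :=
  pselect (forall x, M x -> x j 0 = 0); first exact: Or31.
have [?|/existsNP[m Nm]] := pselect (forall m, exists2 x, M x & x j 0 = t ^- m).
  exact: Or32.
have [_ _ MZ] := hM.
pose P i := `[< exists2 x, M x & x j 0 = t ^+ i / t ^+ m >].
have val_le x : M x -> x j 0 != 0 ->
    exists i (u : O), P i /\ x j 0 = iota u * (t ^+ i / t ^+ m).
  move=> Mx; case/laurent_neq0P => d [e [u [uu xE]]].
  have uV : iota u^-1 * iota u = 1 by rewrite -rmorphM mulVr // rmorph1.
  have Mux : M (iota u^-1 *: x) by apply: MZ.
  have uxE : (iota u^-1 *: x) j 0 = t ^+ e / t ^+ d.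
    by rewrite mxE xE [t ^+ e * _]mulrC -mulrA mulrA uV mul1r.
  have [le|lt] := leqP d (e + m).
    exists (e + m - d)%N, u.
    have E : t ^+ e / t ^+ d = t ^+ (e + m - d) / t ^+ m.
      apply/eqP; rewrite eqr_div ?laurentX_expf_neq0 // -!exprD subnK //.
    split; first by apply/asboolP; exists (iota u^-1 *: x); rewrite // uxE E.
    by rewrite -E xE mulrCA mulrA.
  (* The value has order below [-m], so a power of [t] moves it to [t^-m]. *)
  case: Nm; exists (iota (fpsX K ^+ (d - (e + m))) *: (iota u^-1 *: x)).
    exact: MZ.
  rewrite mxE uxE rmorphXn mulrA -exprD; apply/eqP.
  rewrite -[t ^- m]mul1r eqr_div ?laurentX_expf_neq0 // mul1r -exprD.
  by rewrite -addnA subnK // ltnW.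
have [i1 [_ [Pi1 _]]] := val_le _ Mx0 x00.
case: (ex_minnP (ex_intro _ i1 Pi1)) => i /asboolP[y My yE] imin.
apply: Or33; exists y; split=> //.
  by rewrite yE mulf_neq0 ?invr_eq0 ?laurentX_expf_neq0.
move=> x Mx; have [->|x0'] := eqVneq (x j 0) 0.
  by exists 0; rewrite rmorph0 mul0r.
have [k [u [/imin ik ->]]] := val_le x Mx x0'.
exists (u * fpsX K ^+ (k - i)); rewrite yE rmorphM rmorphXn -mulrA; congr (_ * _).
by rewrite mulrA -exprD subnK.
Qed.

(** Let [x_m] lift [t^-m].  Then [t x_(m+1) - x_m] is an element
    [u_m + w_m] of the slice, with [u_m] in the [A]-span of [a] and [w_m] in the
    [O]-span of [b].  The vector [y = x_0 + sum_m t^m w_m], which exists because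
    [O] is complete, differs from [t^m x_m] by an element of the [A]-span of [a]
    and one of [t^m] times the [O]-span of [b]; hence [t^-m y] lies in [M]. *)
Lemma lift_line a b : spanned M' a b ->
  (forall m, exists2 x, M x & x j 0 = t ^- m) ->
  exists y, y j 0 = 1 /\ forall c : A, M (c *: y).
Proof.
move=> M'ab xP; have /choice[x xx] m : exists x, M x /\ x j 0 = t ^- m.
  by have [x] := xP m; exists x.
have Mx m := (xx m).1; have xj m := (xx m).2.
have [M0 MD MZ] := hM.
have xS m : M' (t *: x m.+1 - x m).
  split; first by apply: submoduleB => //; apply: MZ.
  by rewrite !mxE !xj exprS invfM mulVKf ?laurentX_neq0 // subrr.
(* [uc m] is the pair of [u_m] and the coefficients of [w_m]. *)
have /choice[uc ucP] m : exists uc : V * (nat -> O), uc.1 \in <<a>>%VS /\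
    t *: x m.+1 = x m + (uc.1 + \sum_(i < size b) iota (uc.2 i) *: b`_i).
  have /M'ab[u [_ [ua [c ->] E]]] := xS m.
  by exists (u, c); split=> //; rewrite -E addrC subrK.
pose u m := (uc m).1; pose c i m := (uc m).2 i.
pose y := x 0%N + \sum_(i < size b) iota (fps_series (c i)) *: b`_i.
have b0 z : z \in a ++ b -> z j 0 = 0 by move=> /(spanned_mem M'ab)[].
exists y; split.
  rewrite mxE xj expr0 invr1 summxE big1 ?addr0 // => i _.
  by rewrite mxE b0 ?mulr0 // mem_cat mem_nth ?orbT.
(* Telescoping the relations between successive lifts. *)
have txm m : t ^+ m *: x m = x 0%N + \sum_(k < m) t ^+ k *: u k
    + \sum_(i < size b) iota (\sum_(k < m) fpsX K ^+ k * c i k) *: b`_i.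
  elim: m => [|m IH].
    rewrite expr0 scale1r big_ord0 addr0 big1 ?addr0 // => i _.
    by rewrite big_ord0 rmorph0 scale0r.
  rewrite exprSr -scalerA (ucP m).2 scalerDr IH scalerDr big_ord_recr /=.
  rewrite scaler_sumr addrACA -!addrA; congr (_ + _); congr (_ + _).
  congr (_ + _); rewrite -big_split; apply: eq_bigr => i _ /=.
  by rewrite big_ord_recr rmorphD /= rmorphM rmorphXn scalerDl scalerA.
have My m : M (t ^- m *: y).
  have -> : t ^- m *: y = x m + (- (t ^- m *: \sum_(k < m) t ^+ k *: u k) +
      \sum_(i < size b) iota (fps_series (fun k => c i (m + k)%N)) *: b`_i).
    apply: (scalerI (laurentX_expf_neq0 K m)).
    rewrite scalerA (divff (laurentX_expf_neq0 K m)) scale1r 2!scalerDr txm scalerN scalerA.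
    rewrite (divff (laurentX_expf_neq0 K m)) scale1r addrAC -!addrA addNKr; congr (_ + _).
    rewrite scaler_sumr -big_split; apply: eq_bigr => i _ /=.
    rewrite scalerA (fps_series_split (c i) m) rmorphD /= scalerDl.
    rewrite addrC; congr (_ *: _ + _).
    by rewrite rmorphM rmorphXn.
  apply: MD; first exact: Mx.
  have [] // : M' (- (t ^- m *: \sum_(k < m) t ^+ k *: u k) +
      \sum_(i < size b) iota (fps_series (fun k => c i (m + k)%N)) *: b`_i).
  apply/M'ab; eexists; eexists; split; last by [].
    rewrite memvN memvZ // memv_suml // => k _; rewrite memvZ //.
    exact: (ucP k).1.
  by exists (fun i => fps_series (fun k => c i (m + k)%N)).
move=> d; have [m [e ->]] := laurentP d.
by rewrite -scalerA; apply: MZ.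
Qed.

Lemma notin_slice_span a b y :
  spanned M' a b -> y j 0 != 0 -> y \notin <<a ++ b>>%VS.
Proof.
move=> M'ab; apply: contraNN => yab; apply/eqP.
by apply: span_coord0 yab => z /(spanned_mem M'ab)[].
Qed.

(** The normal form of the slice where the coordinate vanishes, extended
    by one vector where the coordinate does not vanish: it joins [a] when
    its [A]-line lies in [M], and [b] when it lifts a generator. *)
Lemma extend_slice a b : spanned M' a b -> free (a ++ b) ->
  exists a1 b1, free (a1 ++ b1) /\ spanned M a1 b1.
Proof.
move=> M'ab fab; have [M0 MD MZ] := hM.
case: coordinate_ideal => [Mj|line|[y [My y0 yP]]].
- exists a, b; split=> // x; rewrite -M'ab; split=> [Mx|[]//].
  by split=> //; apply: Mj.
- have [y [y1 My]] := lift_line M'ab line.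
  have yab : y \notin <<a ++ b>>%VS.
    by apply: notin_slice_span M'ab _; rewrite y1 oner_neq0.
  exists (y :: a), b; split; first by rewrite cat_cons free_cons yab fab.
  move=> x; split=> [Mx|[_ [w [/[!span_cons]/memv_addP[_ /vlineP[c ->] [u ua ->]] wb ->]]]].
    have /M'ab[u [w [ua wb E]]] : M' (x - x j 0 *: y).
      split; first exact: submoduleB.
      by rewrite !mxE y1 mulr1 subrr.
    exists (x j 0 *: y + u), w; split=> //.
      by rewrite span_cons memv_add ?memvZ ?memv_line.
    by rewrite -addrA -E addrC subrK.
  rewrite -addrA; apply: MD => //.
  by have [] // : M' (u + w); apply/M'ab; exists u, w.
- have yab := notin_slice_span M'ab y0.
  exists a, (y :: b); split.
    rewrite (perm_free (_ : perm_eq _ (y :: a ++ b))) ?free_cons ?yab //.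
    by rewrite -[y :: b]cat1s perm_catCA.
  move=> x; split=> [Mx|[u [_ [ua /Ospan_cons[c [w [wb ->]]] ->]]]].
    have [c xc] := yP x Mx.
    have /M'ab[u [w [ua wb E]]] : M' (x - iota c *: y).
      split; first by apply: submoduleB => //; apply: MZ.
      by rewrite !mxE xc subrr.
    exists u, (iota c *: y + w); split=> //; first by apply/Ospan_cons; exists c, w.
    by rewrite addrCA -E addrC subrK.
  rewrite addrCA; apply: MD; first exact: MZ.
  by have [] // : M' (u + w); apply/M'ab; exists u, w.
Qed.

End Step.

(** Induction on the number of coordinates that may be nonzero on [M]. *)
Theorem submodule_basis M : is_submodule M ->
  exists a b, free (a ++ b) /\ spanned M a b.
Proof.
move=> hM; suff H d : (d <= n)%N -> forall M, is_submodule M ->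
    (forall x, M x -> forall i : 'I_n, (d <= i)%N -> x i 0 = 0) ->
    exists a b, free (a ++ b) /\ spanned M a b.
  by apply: (H n) => // x _ i; rewrite leqNgt ltn_ord.
elim: d => [|d IH] dn N hN N0.
  exists [::], [::]; split; first by rewrite /free span_nil dimv0.
  move=> x; split=> [Nx|[u [w [/[!span_nil]/[!memv0]/eqP -> [c ->] ->]]]].
    exists 0, 0; split; rewrite ?mem0v ?addr0 //; first exact: Ospan0.
    by apply/matrixP => i k; rewrite ord1 mxE N0.
  by rewrite big_ord0 addr0; case: hN.
pose N' : set V := [set x | N x /\ x (Ordinal dn) 0 = 0].
have sl x : N' x -> forall i : 'I_n, (d <= i)%N -> x i 0 = 0.
  move=> [Nx xd] i; rewrite leq_eqVlt => /orP[/eqP di|]; last exact: N0.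
  by rewrite (_ : i = Ordinal dn) //; apply: val_inj.
have [a [b [fab Nab]]] := IH (ltnW dn) N' (slice_submodule (Ordinal dn) hN) sl.
exact: (extend_slice hN Nab fab).
Qed.

Lemma free_GL s : free s -> (size s <= n)%N /\
  exists g : GL K n, forall i : 'I_n, (i < size s)%N -> col i (val g) = s`_i.
Proof.
move=> fs; pose b := s ++ vbasis (<<s>>^C)%VS.
have bb : basis_of fullv b.
  rewrite -(addv_complf <<s>>%VS); apply: cat_basis; last exact: vbasisP.
    by apply/directv_addP; apply: capv_compl.
  by rewrite basisEfree fs subvv /=; move: fs; rewrite /free => /eqP ->.
have sb : size b = n.
  by rewrite -[RHS]muln1; have <- := size_basis (X := in_tuple b) bb; rewrite dimvf.
split; first by rewrite -[leqRHS]sb size_cat leq_addr.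
pose g : 'M[A]_n := \matrix_(i, j) b`_j i 0.
pose h : 'M[A]_n := \matrix_(i, j) coord (in_tuple b) (cast_ord (esym sb) i) (delta_mx j 0).
(* Column [j] of [h] lists the coordinates of the [j]-th unit vector. *)
have gh : g *m h = 1%:M.
  apply/matrixP => i j.
  have := coord_basis (X := in_tuple b) bb (memvf (delta_mx j 0 : V)).
  move/(congr1 (fun x : V => x i 0)); rewrite mxE eqxx andbT => E.
  rewrite mxE [RHS]mxE E summxE.
  rewrite (reindex (cast_ord (esym sb))) /=; last first.
    by exists (cast_ord sb) => k _; apply: val_inj.
  by apply: eq_bigr => k _; rewrite !mxE mulrC.
have [gu _] := mulmx1_unit gh.
exists (exist _ g gu) => i si; apply/matrixP => k l.
by rewrite !mxE ord1 nth_cat si.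
Qed.

End Structure.

(** * The actions of GL_n(A) and the standard lattice *)

Section Actions.
Variables (K : fieldType) (n : nat).
Local Notation A := (laurent K).
Local Notation iota := (@laurent_of_fps K).
Local Notation V := 'cV[A]_n.
Implicit Types (g h : GL K n) (M N : set V) (U : {vspace V}).

Lemma GL_valM g h : val (g * h)%g = val g *m val h. Proof. by []. Qed.
Lemma GL_val1 : val (1%g : GL K n) = 1%:M. Proof. by []. Qed.
Lemma GL_valV g : val g^-1%g = invmx (val g). Proof. by []. Qed.
Lemma GL_mulVx g : val g^-1%g *m val g = 1%:M.
Proof. by rewrite -GL_valM mulVg. Qed.
Lemma GL_mulxV g : val g *m val g^-1%g = 1%:M.
Proof. by rewrite -GL_valM mulgV. Qed.

Lemma act_sub1 M : act_sub K n 1%g M = M.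
Proof.
apply/seteqP; split=> [_ [x Mx <-]|x Mx]; rewrite ?mul1mx //.
by exists x => //; rewrite mul1mx.
Qed.

Lemma act_subM g h M :
  act_sub K n (g * h)%g M = act_sub K n g (act_sub K n h M).
Proof.
apply/seteqP; split=> [_ [x Mx <-]|_ [_ [x Mx <-] <-]].
  by exists (val h *m x); [exists x | rewrite mulmxA].
by exists x => //; rewrite mulmxA.
Qed.

Lemma mem_act_sub g M x : act_sub K n g M x <-> M (val g^-1%g *m x).
Proof.
split=> [[y My <-]|Mx]; first by rewrite mulmxA (GL_mulVx g) mul1mx.
by exists (val g^-1%g *m x) => //; rewrite mulmxA (GL_mulxV g) mul1mx.
Qed.

Lemma act_sub_submodule g M : is_submodule M -> is_submodule (act_sub K n g M).
Proof.
case=> M0 MD MZ; split.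
- by exists 0; rewrite ?mulmx0.
- move=> _ _ [x Mx <-] [y My <-]; exists (x + y); first exact: MD.
  by rewrite mulmxDr.
- move=> a _ [x Mx <-]; exists (iota a *: x); first exact: MZ.
  by rewrite -scalemxAr.
Qed.

Lemma linfun_mulmxE (X : 'M[A]_n) x : linfun (@mulmx _ n n 1 X) x = X *m x.
Proof. by rewrite lfunE. Qed.

Lemma mem_act_vspace g U x :
  (x \in linfun (mulmx (val g)) @: U)%VS = (val g^-1%g *m x \in U).
Proof.
apply/memv_imgP/idP => [[u uU ->]|xU].
  by rewrite linfun_mulmxE mulmxA (GL_mulVx g) mul1mx.
exists (val g^-1%g *m x); first exact: xU.
by rewrite linfun_mulmxE mulmxA (GL_mulxV g) mul1mx.
Qed.

Lemma dim_act_vspace g U : \dim (linfun (mulmx (val g)) @: U)%VS = \dim U.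
Proof.
apply: limg_dim_eq; apply/eqP; rewrite -subv0; apply/subvP => x.
rewrite memv_cap memv_ker linfun_mulmxE memv0 => /andP[_ /eqP gx].
by rewrite -[x]mul1mx -(GL_mulVx g) -mulmxA gx mulmx0.
Qed.

Lemma act_flag1 F : act_flag K n 1%g F = F.
Proof.
by case: F => U W; congr pair; apply/vspaceP => x;
  rewrite mem_act_vspace invg1 mul1mx.
Qed.

Lemma act_flagM g h F :
  act_flag K n (g * h)%g F = act_flag K n g (act_flag K n h F).
Proof.
have E U : (linfun (mulmx (val (g * h)%g)) @: U =
    linfun (mulmx (val g)) @: (linfun (mulmx (val h)) @: U))%VS.
  apply/vspaceP => x; rewrite [LHS]mem_act_vspace [RHS]mem_act_vspace.
  by rewrite [RHS]mem_act_vspace invgM GL_valM -mulmxA.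
by rewrite /act_flag (E F.1) (E F.2).
Qed.

(** [core] and [span_set] are defined by the module structure alone. *)
Lemma rho_act g M : is_submodule M ->
  rho (act_sub K n g M) = act_flag K n g (rho M).
Proof.
move=> hM; have hgM := act_sub_submodule g hM; congr pair.
  apply/vspaceP => x; rewrite mem_act_vspace.
  apply/idP/idP => [/(mem_core _ hgM)[]|/(mem_core _ hM)[]].
    move=> /mem_act_sub Mx Lx; apply/(mem_core _ hM); split=> // a.
    by have /mem_act_sub := Lx a; rewrite -scalemxAr.
  move=> Mx Lx; apply/(mem_core _ hgM); split; first exact/mem_act_sub.
  by move=> a; apply/mem_act_sub; rewrite -scalemxAr.
apply/eqP; rewrite eqEsubv; apply/andP; split.
  apply: span_set_min => x /mem_act_sub Mx.
  by rewrite mem_act_vspace span_set_sub.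
apply/subvP => x; rewrite mem_act_vspace => xM.
suff /subvP/(_ _ xM) : (span_set M <=
    linfun (mulmx (val g^-1%g)) @: span_set (act_sub K n g M))%VS.
  by rewrite mem_act_vspace invgK mulmxA (GL_mulxV g) mul1mx.
apply: span_set_min => y My; rewrite mem_act_vspace invgK.
by apply: span_set_sub; exists y.
Qed.

Lemma act_flag_variety g F d1 d2 d3 :
  flag_variety K n d1 d2 d3 F -> flag_variety K n d1 d2 d3 (act_flag K n g F).
Proof.
case=> F12 d1E d2E d3E; split; rewrite /= ?dim_act_vspace //.
exact: limgS.
Qed.

Definition standard_lattice : set V := [set x | exists y, x = map_mx iota y].

Lemma map_mx_iota_inj p q :
  injective (map_mx iota : 'M[fps K]_(p, q) -> 'M[A]_(p, q)).
Proof.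
move=> X Y /matrixP E; apply/matrixP => i j; apply: laurent_of_fps_inj.
by have := E i j; rewrite !mxE.
Qed.

(** If [g] and [g^-1] preserve [O^n], their columns are integral, so
    [g] is an invertible matrix over [O]. *)
Lemma act_stab_standard_lattice :
  act_stab (act_sub K n) standard_lattice = GLO K n.
Proof.
have int g : act_stab (act_sub K n) standard_lattice g ->
    exists Z, val g = map_mx iota Z.
  move=> gO; have /choice[z zP] : forall j, exists y, col j (val g) = map_mx iota y.
    move=> j; have : standard_lattice (col j (val g)) by
      rewrite -gO; exists (delta_mx j 0); rewrite -?colE //;
      exists (delta_mx j 0); rewrite map_delta_mx.
    by case=> y ->; exists y.
  exists (\matrix_(i, j) z j i 0); apply/matrixP => i j.
  by have /matrixP/(_ i 0) := zP j; rewrite !mxE.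
apply/seteqP; split=> g.
  move=> gO; have [Z ZE] := int g gO.
  have [Y YE] := int _ (act_stabV act_sub1 act_subM gO).
  exists Z => //; have := GL_mulxV g; rewrite YE ZE -map_mxM -(map_mx1 iota).
  by move/map_mx_iota_inj/mulmx1_unit=> -[].
case=> h hu gE; rewrite /act_stab /=; apply/seteqP; split=> x.
  by case=> _ [y ->] <-; exists (h *m y); rewrite gE map_mxM.
case=> y ->; exists (map_mx iota (invmx h *m y)); first by exists (invmx h *m y).
by rewrite gE -map_mxM mulmxA mulmxV // mul1mx.
Qed.

Lemma lattice_clear_denominator g x :
  exists m, act_sub K n g standard_lattice (laurentX K ^+ m *: x).
Proof.
have [m [z zE]] := mx_clear_denominator (val g^-1%g *m x).
exists m; apply/mem_act_sub; exists z.
by rewrite -scalemxAr zE expr0 scale1r.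
Qed.

(** A nonzero coordinate [y_i] would give the integral element [y_i] times
    [1 / (t y_i)], that is [1 / t]. *)
Lemma lattice_no_line g x :
  (forall a, act_sub K n g standard_lattice (a *: x)) -> x = 0.
Proof.
move=> gx; suff H y : (forall a, standard_lattice (a *: y)) -> y = 0.
  rewrite -[x]mul1mx -(GL_mulxV g) -mulmxA.
  rewrite (H (val g^-1%g *m x)) ?mulmx0 // => a.
  by rewrite scalemxAr; apply/mem_act_sub.
move=> yO; apply/matrixP => i j; rewrite ord1 [RHS]mxE; apply/eqP/negPn/negP => y0.
have [z /matrixP/(_ i 0)] := yO ((y i 0)^-1 / laurentX K).
rewrite !mxE mulrAC (mulVf y0) mul1r => /(congr1 ( *%R (laurentX K))).
rewrite (divff (laurentX_neq0 K)) -rmorphM -(rmorph1 iota) => /laurent_of_fps_inj.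
by move/(congr1 (fun f : fps K => f 0%N)) => /esym/eqP; rewrite fpsXM0 fpsE1 eq_sym oner_eq0.
Qed.

End Actions.

(** * Frames and a section over the cell of transverse flags *)

Section Compression.
Variables (F : fieldType) (n : nat) (P : 'M[F]_n).
Hypothesis PP : P *m P = P.
Implicit Types g p : 'M[F]_n.

(** The compression of [g] to the image of [P], extended by the identity so
    that it is a square matrix of size [n].  For invertible [g] it is
    invertible exactly when [g (im P)] is transverse to the kernel of [P]. *)
Definition compression g : 'M_n := P *m g *m P + (1%:M - P).

Lemma compression1 : compression 1%:M = 1%:M.
Proof. by rewrite /compression mulmx1 PP addrC subrK. Qed.

Lemma mul_compression g : P *m compression g = P *m g *m P.
Proof. by rewrite mulmxDr mulmxBr mulmx1 PP subrr addr0 !mulmxA PP. Qed.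

(** Compression is multiplicative when the right factor preserves the
    image of [P]. *)
Lemma compressionM g p : p *m P = P *m p *m P ->
  compression (g *m p) = compression g *m compression p.
Proof.
move=> pP; rewrite [RHS]mulmxDl -[P *m g *m P *m _]mulmxA mul_compression.
rewrite [(1%:M - P) *m _]mulmxBl mul1mx mul_compression {1}/compression.
rewrite [compression p]/compression addrAC subrr add0r; congr (_ + _).
by rewrite -!mulmxA [p *m P]pP !mulmxA -[P *m g *m P *m P]mulmxA PP.
Qed.

Lemma compression_unit g p : p *m P = P *m p *m P -> g *m p = 1%:M ->
  compression p \in unitmx.
Proof.
move=> pP gp; have := compressionM g pP.
by rewrite gp compression1 => /esym/mulmx1_unit[].
Qed.

(** For [g (im P)] transverse to the kernel of [P], the inverse of the
    projection from [g (im P)] to [im P], preceded by [P]: [g (im P)] is the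
    graph of the component of this map in the kernel of [P]. *)
Definition graph_map g : 'M_n := g *m P *m invmx (compression g) *m P.

(** The map only depends on the subspace [g (im P)]. *)
Lemma graph_map_stable g p : p *m P = P *m p *m P ->
  compression g \in unitmx -> compression p \in unitmx ->
  graph_map (g *m p) = graph_map g.
Proof.
move=> pP gu pu; rewrite /graph_map compressionM //.
have -> : invmx (compression g *m compression p) =
    invmx (compression p) *m invmx (compression g).
  have gpu : compression g *m compression p \in unitmx by rewrite unitmx_mul gu.
  apply: (can_inj (mulKmx gpu)); rewrite (mulmxV gpu) -!mulmxA.
  by rewrite (mulKVmx pu) (mulmxV gu).
rewrite -[g *m p *m P]mulmxA pP -mul_compression !mulmxA.
by rewrite -[_ *m compression p *m _]mulmxA (mulmxV pu) mulmx1.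
Qed.

Lemma mul_graph_map g : compression g \in unitmx -> P *m graph_map g = P.
Proof.
by move=> gu; rewrite !mulmxA -mul_compression -[P *m _ *m _]mulmxA (mulmxV gu) mulmx1 PP.
Qed.

Lemma graph_mapP g : graph_map g *m P = graph_map g.
Proof. by rewrite -[LHS]mulmxA PP. Qed.

Lemma graph_map_range g h : h *m g = 1%:M -> P *m (h *m graph_map g) = h *m graph_map g.
Proof. by move=> hg; rewrite !mulmxA -[P *m h *m g]mulmxA hg mulmx1 mul1mx PP. Qed.

End Compression.

(** Coordinates for a flag with steps of dimensions [k] and [k + r]: the
    columns of [core_in] and [gr_in] are bases of the first step and of a
    complement of it in the second, and [core_out], [gr_out] are the
    corresponding coordinate functions on the whole space. *)
Record frame (F : fieldType) (n k r : nat) := Frame {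
  core_in : 'M[F]_(n, k);
  gr_in : 'M[F]_(n, r);
  core_out : 'M[F]_(k, n);
  gr_out : 'M[F]_(r, n);
  core_outK : core_out *m core_in = 1%:M;
  gr_outK : gr_out *m gr_in = 1%:M;
  core_out_gr : core_out *m gr_in = 0;
  gr_out_core : gr_out *m core_in = 0 }.

Section FrameTheory.
Variables (F : fieldType) (n k r : nat) (fr : frame F n k r).
Implicit Types (g p : 'M[F]_n) (h : 'M[F]_r).

Local Notation Ja := (core_in fr).
Local Notation Jb := (gr_in fr).
Local Notation Qa := (core_out fr).
Local Notation Qb := (gr_out fr).

(** Locked, as is [span_proj], so that rewriting with associativity does not
    unfold it into a product. *)
Definition core_proj : 'M_n := locked (Ja *m Qa).
Definition span_proj : 'M_n := locked (core_proj + Jb *m Qb).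
Local Notation P1 := core_proj.
Local Notation P2 := span_proj.

Lemma core_projE : P1 = Ja *m Qa. Proof. by rewrite /core_proj -lock. Qed.
Lemma span_projE : P2 = P1 + Jb *m Qb. Proof. by rewrite /span_proj -lock. Qed.

Lemma core_out_inK m (x : 'M_(k, m)) : Qa *m (Ja *m x) = x.
Proof. by rewrite mulmxA core_outK mul1mx. Qed.
Lemma gr_out_inK m (x : 'M_(r, m)) : Qb *m (Jb *m x) = x.
Proof. by rewrite mulmxA gr_outK mul1mx. Qed.
Lemma gr_out_core_in0 m (x : 'M_(k, m)) : Qb *m (Ja *m x) = 0.
Proof. by rewrite mulmxA gr_out_core mul0mx. Qed.

Lemma core_proj_idem : P1 *m P1 = P1.
Proof. by rewrite core_projE -mulmxA core_out_inK. Qed.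
Lemma core_proj_in : P1 *m Ja = Ja.
Proof. by rewrite core_projE -mulmxA core_outK mulmx1. Qed.
Lemma core_proj_gr : P1 *m Jb = 0.
Proof. by rewrite core_projE -mulmxA core_out_gr mulmx0. Qed.
Lemma span_proj_core : P2 *m Ja = Ja.
Proof. by rewrite span_projE mulmxDl core_proj_in -mulmxA gr_out_core mulmx0 addr0. Qed.
Lemma span_proj_gr : P2 *m Jb = Jb.
Proof. by rewrite span_projE mulmxDl core_proj_gr -mulmxA gr_outK mulmx1 add0r. Qed.
Lemma gr_out_core_proj : Qb *m P1 = 0.
Proof. by rewrite core_projE gr_out_core_in0. Qed.
Lemma gr_out_span_proj : Qb *m P2 = Qb.
Proof. by rewrite span_projE mulmxDr gr_out_core_proj gr_out_inK add0r. Qed.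
Lemma span_core_proj : P2 *m P1 = P1.
Proof. by rewrite core_projE mulmxA span_proj_core. Qed.
Lemma core_span_proj : P1 *m P2 = P1.
Proof. by rewrite span_projE mulmxDr core_proj_idem mulmxA core_proj_gr mul0mx addr0. Qed.
Lemma span_proj_idem : P2 *m P2 = P2.
Proof. by rewrite {2 3}span_projE mulmxDr span_core_proj mulmxA span_proj_gr. Qed.

Definition preserves g : Prop := g *m P1 = P1 *m g *m P1 /\ g *m P2 = P2 *m g *m P2.

(** The action induced by [g] on the quotient of the two steps. *)
Definition gr_mx g : 'M_r := Qb *m g *m Jb.

(** Between the two factors, [gr_in *m gr_out] may be replaced by the
    identity: on the second step it is 1 minus the projection to the first
    step, and what passes through the first step is killed by [gr_out]. *)
Lemma gr_mxM g p : preserves g -> preserves p -> gr_mx (g *m p) = gr_mx g *m gr_mx p.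
Proof.
case=> g1 _ [_ p2]; rewrite /gr_mx.
have -> : Qb *m g *m Jb *m (Qb *m p *m Jb) = Qb *m g *m (P2 - P1) *m p *m Jb.
  by rewrite span_projE addrAC subrr add0r !mulmxA.
rewrite mulmxBr -[Qb *m g *m P1]mulmxA g1 !mulmxA gr_out_core_proj !mul0mx subr0.
rewrite -[in RHS]span_proj_gr -!mulmxA [P2 *m (p *m (P2 *m Jb))]mulmxA.
by rewrite [P2 *m p *m _]mulmxA -p2 -mulmxA span_proj_gr.
Qed.

Lemma gr_mx1 : gr_mx 1%:M = 1%:M.
Proof. by rewrite /gr_mx mulmx1 gr_outK. Qed.

(** [h] acting on the span of [gr_in], and the identity on the kernel of
    [gr_out]. *)
Definition gr_lift h : 'M_n := 1%:M - Jb *m Qb + Jb *m h *m Qb.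

Lemma gr_lift1 : gr_lift 1%:M = 1%:M.
Proof. by rewrite /gr_lift mulmx1 subrK. Qed.

Lemma gr_out_lift h : Qb *m gr_lift h = h *m Qb.
Proof. by rewrite mulmxDr mulmxBr mulmx1 gr_out_inK subrr add0r -mulmxA gr_out_inK. Qed.

Lemma gr_liftM h h' : gr_lift (h *m h') = gr_lift h *m gr_lift h'.
Proof.
rewrite [RHS]mulmxDl mulmxBl mul1mx -!mulmxA gr_out_lift.
by rewrite [gr_lift h']/gr_lift -[Jb *m h' *m Qb]mulmxA addrK /gr_lift !mulmxA.
Qed.

Lemma gr_mx_lift h : gr_mx (gr_lift h) = h.
Proof. by rewrite /gr_mx gr_out_lift -mulmxA gr_outK mulmx1. Qed.

Lemma preserves_lift h : preserves (gr_lift h).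
Proof.
have E1 : gr_lift h *m P1 = P1.
  by rewrite mulmxDl mulmxBl mul1mx -!mulmxA gr_out_core_proj !mulmx0 subr0 addr0.
have E2 : gr_lift h *m P2 = P2 - Jb *m Qb + Jb *m h *m Qb.
  by rewrite mulmxDl mulmxBl mul1mx -!mulmxA gr_out_span_proj.
split; first by rewrite -mulmxA E1 core_proj_idem.
by rewrite -mulmxA E2 mulmxDr mulmxBr span_proj_idem !mulmxA span_proj_gr.
Qed.

(** For invertible [g], the flag obtained by applying [g] is transverse to
    the kernels of the two
    projections. *)
Definition in_cell g : Prop :=
  compression P1 g \in unitmx /\ compression P2 g \in unitmx.

Lemma in_cell1 : in_cell 1%:M.
Proof. by split; rewrite compression1 ?core_proj_idem ?span_proj_idem ?unitmx1. Qed.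

(** Sends each vector of the first step, of its complement in the second
    step, and of the kernel of [P2] respectively to its lift in the first step
    of the flag of [g], to its lift in the second step, and to itself.  It is
    unipotent with respect to this decomposition. *)
Definition cell_section g : 'M_n :=
  graph_map P1 g + graph_map P2 g *m (P2 - P1) + (1%:M - P2).

Lemma cell_section_core g : cell_section g *m P1 = graph_map P1 g.
Proof.
rewrite 2!mulmxDl graph_mapP ?core_proj_idem // -mulmxA mulmxBl span_core_proj core_proj_idem.
by rewrite subrr mulmx0 mulmxBl mul1mx span_core_proj subrr !addr0.
Qed.

Lemma cell_section_span g :
  cell_section g *m P2 = graph_map P1 g + graph_map P2 g *m (P2 - P1).
Proof.
rewrite 2!mulmxDl -{1}(graph_mapP core_proj_idem) -mulmxA core_span_proj.
rewrite graph_mapP ?core_proj_idem //.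
rewrite -mulmxA mulmxBl span_proj_idem core_span_proj mulmxBl mul1mx.
by rewrite span_proj_idem subrr addr0.
Qed.

Lemma core_cell_section g : in_cell g -> P1 *m cell_section g = P1.
Proof.
case=> g1 g2; rewrite 2!mulmxDr (mul_graph_map core_proj_idem g1).
rewrite -{2}core_span_proj -mulmxA [P2 *m (_ *m _)]mulmxA (mul_graph_map span_proj_idem g2).
rewrite mulmxBr span_proj_idem span_core_proj mulmxBr core_span_proj.
rewrite core_proj_idem subrr addr0.
by rewrite mulmxBr mulmx1 core_span_proj subrr addr0.
Qed.

Lemma span_cell_section g : in_cell g ->
  P2 *m cell_section g = P2 *m cell_section g *m P1 + (P2 - P1).
Proof.
case=> g1 g2; rewrite -[_ *m _ *m P1]mulmxA cell_section_core.
rewrite 2!mulmxDr [P2 *m (graph_map P2 _ *m _)]mulmxA (mul_graph_map span_proj_idem g2).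
rewrite mulmxBr span_proj_idem span_core_proj [P2 *m (1%:M - _)]mulmxBr mulmx1.
rewrite span_proj_idem subrr.
by rewrite addr0.
Qed.

(** A left inverse can be written down: [P1 s = P1], and the formula for
    [P2 s] makes [Q] satisfy [Q s = P2], while [s] agrees with the identity on
    the kernel of [P2]. *)
Lemma cell_section_unit g : in_cell g -> cell_section g \in unitmx.
Proof.
move=> gc; set s := cell_section g.
pose Q := P2 - P2 *m s *m P1 + P1.
have Qs : Q *m s = P2.
  rewrite mulmxDl mulmxBl -[_ *m P1 *m s]mulmxA (core_cell_section gc).
  by rewrite {1}(span_cell_section gc) -addrA addrACA subrr add0r subrK.
have sP2 : s - s *m P2 = 1%:M - P2.
  by rewrite cell_section_span /s /cell_section addrAC subrr add0r.
suff E : (1%:M - s *m Q + Q) *m s = 1%:M by have [] := mulmx1_unit E.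
by rewrite mulmxDl mulmxBl mul1mx -mulmxA Qs sP2 subrK.
Qed.

(** The section only depends on the flag of [g]. *)
Lemma cell_section_stable g p p' : preserves p -> p' *m p = 1%:M ->
  in_cell g -> cell_section (g *m p) = cell_section g.
Proof.
case=> p1 p2 p'p [g1 g2]; rewrite /cell_section.
rewrite (graph_map_stable core_proj_idem p1 g1 (compression_unit core_proj_idem p1 p'p)).
by rewrite (graph_map_stable span_proj_idem p2 g2 (compression_unit span_proj_idem p2 p'p)).
Qed.

Lemma in_cell_stable g p p' : preserves p -> p' *m p = 1%:M ->
  in_cell g -> in_cell (g *m p).
Proof.
case=> p1 p2 p'p [g1 g2]; split; rewrite compressionM ?core_proj_idem ?span_proj_idem //.
  by rewrite unitmx_mul g1 (compression_unit core_proj_idem p1 p'p).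
by rewrite unitmx_mul g2 (compression_unit span_proj_idem p2 p'p).
Qed.

(** [cell_section g] and [g] move the flag to the same place. *)
Lemma cell_section_preserves g g' :
  g' *m g = 1%:M -> preserves (g' *m cell_section g).
Proof.
move=> g'g; split; rewrite -!mulmxA ?cell_section_core ?cell_section_span.
  by rewrite (graph_map_range core_proj_idem).
rewrite [g' *m (_ + _)]mulmxDr [RHS]mulmxDr; congr (_ + _).
  by rewrite -(graph_map_range core_proj_idem g'g) [RHS]mulmxA span_core_proj.
by rewrite [g' *m _]mulmxA [RHS]mulmxA (graph_map_range span_proj_idem).
Qed.

End FrameTheory.

Section StandardFrame.
Variables (F : fieldType) (n k r : nat).
Hypothesis krn : (k + r <= n)%N.

(** The inclusion of [m] consecutive basis vectors, the first of which has
    index [off]. *)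
Definition block_in off m : 'M[F]_(n, m) :=
  \matrix_(i, j) (i == off + j :> nat)%N%:R.

Lemma block_inK off m off' m' : (off + m <= n)%N -> forall (i : 'I_m) (j : 'I_m'),
  ((block_in off m)^T *m block_in off' m') i j = (off + i == off' + j)%N%:R.
Proof.
move=> offm i j; rewrite !mxE.
have lt : (off + i < n)%N by rewrite (leq_trans _ offm) // ltn_add2l.
rewrite (bigD1 (Ordinal lt)) //= !mxE eqxx mul1r big1 ?addr0 // => a.
by rewrite -val_eqE !mxE /= => /negbTE ->; rewrite mul0r.
Qed.

Definition standard_frame : frame F n k r.
Proof.
apply: (@Frame F n k r (block_in 0 k) (block_in k r) (block_in 0 k)^T (block_in k r)^T);
  apply/matrixP => i j; rewrite block_inK ?(leq_trans (leq_addr _ _) krn) // !mxE.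
- by rewrite eqn_add2l.
- by rewrite eqn_add2l.
- by rewrite (@ltn_eqF (0 + i)) // add0n ltn_addr.
- by rewrite (@gtn_eqF (0 + j)) // add0n ltn_addr.
Defined.

End StandardFrame.

Definition frame_act (F : fieldType) n k r (g : 'M[F]_n) (gu : g \in unitmx)
  (fr : frame F n k r) : frame F n k r.
Proof.
apply: (@Frame F n k r (g *m core_in fr) (g *m gr_in fr)
  (core_out fr *m invmx g) (gr_out fr *m invmx g));
  by rewrite mulmxA (mulmxKV gu) ?core_outK ?gr_outK ?core_out_gr ?gr_out_core.
Defined.

(** * Submodules lying over a flag *)

Lemma mulmx_cV_inj (F : fieldType) m n (X Y : 'M[F]_(m, n)) :
  (forall x : 'cV_n, X *m x = Y *m x) -> X = Y.
Proof.
move=> XY; apply/matrixP => i j.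
by have /matrixP/(_ i 0) := XY (delta_mx j 0); rewrite -!colE !mxE.
Qed.

Section Lattices.
Variables (K : fieldType) (n k r : nat).
Local Notation A := (laurent K).
Local Notation iota := (@laurent_of_fps K).
Local Notation V := 'cV[A]_n.
Local Notation Olat := (@standard_lattice K r).
Implicit Types (fr : frame A n k r) (F : flag K n) (g p : GL K n) (h : GL K r).

Definition is_image_of (U : {vspace V}) (P : 'M[A]_n) : Prop :=
  forall x, x \in U <-> P *m x = x.

Definition flag_at fr F : Prop :=
  is_image_of F.1 (core_proj fr) /\ is_image_of F.2 (span_proj fr).

(** The preimage, under the coordinates [gr_out] on the second step, of the
    lattice [h O^r]. *)
Definition lattice_at fr h : set V :=
  [set x | span_proj fr *m x = x /\ act_sub K r h Olat (gr_out fr *m x)].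

Lemma stable_imageP (U : {vspace V}) (P : 'M[A]_n) p : P *m P = P -> is_image_of U P ->
  (linfun (mulmx (val p)) @: U)%VS = U <-> val p *m P = P *m val p *m P.
Proof.
move=> PP UP; split=> [pU|pP].
  apply: mulmx_cV_inj => x.
  have pPx : P *m (val p *m (P *m x)) = val p *m (P *m x).
    apply/UP; rewrite -pU mem_act_vspace mulmxA (GL_mulVx p) mul1mx; apply/UP.
    by rewrite mulmxA PP.
  by rewrite -[LHS]mulmxA -pPx !mulmxA.
apply/eqP; rewrite eqEdim dim_act_vspace leqnn andbT; apply/subvP => x.
rewrite mem_act_vspace => /UP xE; apply/UP.
have {1}-> : x = val p *m P *m (val p^-1%g *m x).
  by rewrite -mulmxA xE mulmxA (GL_mulxV p) mul1mx.
by rewrite mulmxA [P *m (_ *m _)]mulmxA -pP -mulmxA xE mulmxA (GL_mulxV p) mul1mx.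
Qed.

(** An invertible matrix that maps a subspace into itself maps it onto
    itself, by dimension; so inclusions suffice. *)
Lemma flag_stabP fr F p : flag_at fr F ->
  act_stab (act_flag K n) F p <-> preserves fr (val p).
Proof.
case=> F1 F2; have [c1 c2] := stable_imageP p (core_proj_idem fr) F1.
have [s1 s2] := stable_imageP p (span_proj_idem fr) F2; split.
  by case: F F1 F2 c1 c2 s1 s2 => U W F1 F2 c1 _ s1 _ [/c1 ? /s1 ?]; split.
case=> /c2 E1 /s2 E2; rewrite /act_stab /= /act_flag E1 E2.
by case: F {F1 F2 c1 c2 s1 s2 E1 E2}.
Qed.

Lemma core_proj_act fr g :
  core_proj (frame_act (valP g) fr) = val g *m core_proj fr *m val g^-1%g.
Proof. by rewrite !core_projE /= !mulmxA. Qed.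

Lemma span_proj_act fr g :
  span_proj (frame_act (valP g) fr) = val g *m span_proj fr *m val g^-1%g.
Proof. by rewrite !span_projE core_proj_act /= mulmxDr mulmxDl !mulmxA. Qed.

Lemma gr_out_act fr g :
  gr_out (frame_act (valP g) fr) = gr_out fr *m val g^-1%g.
Proof. by rewrite GL_valV /=. Qed.

Lemma conj_fixP g (P : 'M[A]_n) (x : V) :
  val g *m P *m val g^-1%g *m x = x <-> P *m (val g^-1%g *m x) = val g^-1%g *m x.
Proof.
split=> [{2}<-|E]; first by rewrite -!mulmxA [RHS]mulmxA (GL_mulVx g) mul1mx.
by rewrite -2!mulmxA E mulmxA (GL_mulxV g) mul1mx.
Qed.

Lemma lattice_at_act fr g h :
  lattice_at (frame_act (valP g) fr) h = act_sub K n g (lattice_at fr h).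
Proof.
apply/seteqP; split=> x.
  case; rewrite span_proj_act => /conj_fixP Px Qx; apply/mem_act_sub; split=> //.
  by rewrite gr_out_act -mulmxA in Qx.
move=> /mem_act_sub[Px Qx]; split; first by rewrite span_proj_act; apply/conj_fixP.
by rewrite gr_out_act -mulmxA.
Qed.

(** A line lies in [lattice_at fr h] only if its image in the lattice
    [h O^r] is zero, which puts it in the first step; and every vector of the
    second step has a multiple by a power of [t] in [lattice_at fr h]. *)
Lemma rho_lattice_at fr F h : is_submodule (lattice_at fr h) -> flag_at fr F ->
  rho (lattice_at fr h) = F.
Proof.
move=> hL; case: F => U W [/= UP WP]; congr pair.
  apply/vspaceP => x; apply/idP/idP => [/(mem_core _ hL)[[Px _] Lx]|/UP Px].
    apply/UP; suff Qx : gr_out fr *m x = 0.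
      by rewrite -{2}Px span_projE mulmxDl -mulmxA Qx mulmx0 addr0.
    apply: (@lattice_no_line K r h) => a.
    by have [_] := Lx a; rewrite -scalemxAr.
  have P2x : span_proj fr *m x = x by rewrite -Px mulmxA span_core_proj.
  have Qx : gr_out fr *m x = 0 by rewrite -Px mulmxA gr_out_core_proj mul0mx.
  have Lx a : lattice_at fr h (a *: x).
    split; rewrite -scalemxAr ?P2x // Qx scaler0.
    by apply/mem_act_sub; rewrite mulmx0; exists 0; rewrite map_mx0.
  by apply/(mem_core _ hL); split=> //; rewrite -[x]scale1r.
apply/eqP; rewrite eqEsubv; apply/andP; split.
  by apply: span_set_min => x [Px _]; apply/WP.
apply/subvP => x /WP Px.
have [m mx] := lattice_clear_denominator h (gr_out fr *m x).
rewrite -[x]scale1r -(mulVf (laurentX_expf_neq0 K m)) -scalerA memvZ //.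
by apply: span_set_sub; split; rewrite -scalemxAr ?Px.
Qed.

Lemma lattice_at_gr_in fr h y :
  lattice_at fr h (gr_in fr *m y) <-> act_sub K r h Olat y.
Proof.
split=> [[_]|yL]; rewrite ?gr_out_inK //.
by split; rewrite ?gr_out_inK // mulmxA span_proj_gr.
Qed.

Lemma ltranslate_GLO h o : GLO K r o ->
  ltranslate (h * o)%g (GLO K r) = ltranslate h (GLO K r).
Proof.
rewrite -act_stab_standard_lattice => oO; have stM := act_stabM (@act_subM K r).
rewrite ltranslateM; congr ltranslate; apply/seteqP; split=> [_ [c cO <-]|c cO].
  exact: stM.
exists (o^-1 * c)%g; last by rewrite mulgA mulgV mul1g.
by apply: stM cO; apply: (act_stabV (@act_sub1 K r) (@act_subM K r)).
Qed.

Lemma GLO1 : GLO K r 1%g.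
Proof. by rewrite -act_stab_standard_lattice; exact: act_sub1. Qed.

(** The lattice [h O^r] is recovered from [lattice_at fr h] along [gr_in],
    and the stabiliser of [O^r] is [GLO]. *)
Lemma lattice_atP fr h h' :
  lattice_at fr h = lattice_at fr h' <-> ltranslate h (GLO K r) h'.
Proof.
split=> [E|[o oO <-]].
  exists (h^-1 * h')%g; last by rewrite mulgA mulgV mul1g.
  have LE : act_sub K r h Olat = act_sub K r h' Olat.
    apply/seteqP; split=> y /(lattice_at_gr_in fr).
      by rewrite E => /lattice_at_gr_in.
    by rewrite -E => /lattice_at_gr_in.
  rewrite -act_stab_standard_lattice /act_stab /= act_subM -LE.
  exact: (actK (@act_sub1 K r) (@act_subM K r)).
move: oO; rewrite -act_stab_standard_lattice /lattice_at act_subM => oO.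
by rewrite [act_sub K r o _]oO.
Qed.

Lemma lattice_at_coset fr h h' :
  lattice_at fr h = lattice_at fr h' -> ltranslate h (GLO K r) = ltranslate h' (GLO K r).
Proof. by move/lattice_atP => [o oO <-]; rewrite ltranslate_GLO. Qed.

Definition lattice_of_coset fr (c : set (GL K r)) : set V :=
  [set x | exists2 h, c h & lattice_at fr h x].

(** The inverse of [lattice_of_coset] on the submodules [lattice_at fr h]. *)
Definition coset_of_lattice fr (N : set V) : set (GL K r) :=
  [set h | N = lattice_at fr h].

Lemma lattice_of_cosetE fr h :
  lattice_of_coset fr (ltranslate h (GLO K r)) = lattice_at fr h.
Proof.
apply/seteqP; split=> x; first by case=> h' /(lattice_atP fr) <-.
by move=> hx; exists h => //; exists 1%g; [exact: GLO1 | rewrite mulg1].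
Qed.

Lemma coset_of_latticeE fr h :
  coset_of_lattice fr (lattice_at fr h) = ltranslate h (GLO K r).
Proof. by apply/seteqP; split=> h' /(lattice_atP fr). Qed.

(** The default value 1 is never taken on the stabiliser of a flag with
    frame [fr]; locked to keep unification from unfolding it. *)
Definition grGL fr p : GL K r :=
  locked (insubd (1%g : GL K r) (gr_mx fr (val p))).

Lemma gr_lift_unit fr h : gr_lift fr (val h) \in unitmx.
Proof.
have : gr_lift fr (val h) *m gr_lift fr (val h^-1%g) = 1%:M.
  by rewrite -gr_liftM (GL_mulxV h) gr_lift1.
exact: (fun E => (mulmx1_unit E).1).
Qed.

Definition gr_liftGL fr h : GL K n :=
  exist (fun X : 'M_n => is_true (X \in unitmx)) _ (gr_lift_unit fr h).

Section FlagStabiliser.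
Variables (fr : frame A n k r) (F : flag K n).
Hypothesis hF : flag_at fr F.
Local Notation P := (act_stab (act_flag K n) F).

Lemma flag_stabV p : P p -> P p^-1%g.
Proof. exact: (act_stabV (@act_flag1 K n) (@act_flagM K n)). Qed.

Lemma val_grGL p : P p -> val (grGL fr p) = gr_mx fr (val p).
Proof.
move=> Pp; have /(flag_stabP _ hF) pp := Pp.
have /(flag_stabP _ hF) pVp := flag_stabV Pp.
rewrite /grGL -lock insubdK // unfold_in.
have : gr_mx fr (val p) *m gr_mx fr (val p^-1%g) = 1%:M.
  by rewrite -gr_mxM // (GL_mulxV p) gr_mx1.
exact: (fun E => (mulmx1_unit E).1).
Qed.

Lemma grGLM p p' : P p -> P p' -> grGL fr (p * p')%g = (grGL fr p * grGL fr p')%g.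
Proof.
move=> Pp Pp'; have Ppp := act_stabM (@act_flagM K n) Pp Pp'.
have E := gr_mxM ((flag_stabP p hF).1 Pp) ((flag_stabP p' hF).1 Pp').
apply: val_inj; apply: etrans (val_grGL Ppp) (etrans E _).
exact: esym (congr2 mulmx (val_grGL Pp) (val_grGL Pp')).
Qed.

Lemma grGL1 : grGL fr 1%g = 1%g.
Proof.
by apply: val_inj; rewrite val_grGL; [exact: gr_mx1 | exact: act_flag1].
Qed.

Lemma gr_liftGL_stab h : P (gr_liftGL fr h).
Proof. by apply/(flag_stabP _ hF); apply: preserves_lift. Qed.

Lemma grGL_lift h : grGL fr (gr_liftGL fr h) = h.
Proof.
apply: val_inj; rewrite (val_grGL (gr_liftGL_stab h)).
exact: gr_mx_lift.
Qed.

(** On the second step [gr_out] intertwines [p] with the induced matrix,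
    because [p] preserves the first step, where [gr_out] vanishes. *)
Lemma act_lattice_at p h : P p ->
  act_sub K n p (lattice_at fr h) = lattice_at fr (grGL fr p * h)%g.
Proof.
have sub p' h' : P p' -> act_sub K n p' (lattice_at fr h') `<=`
    lattice_at fr (grGL fr p' * h')%g.
  move=> Pp' _ [x [Px [y yO Qx]] <-].
  have /(flag_stabP _ hF)[p1 p2] := Pp'; split.
    by rewrite -{1}Px 2!mulmxA -p2 -mulmxA Px.
  rewrite act_subM; exists (gr_out fr *m x); first by exists y.
  have xE : x = core_proj fr *m x + gr_in fr *m (gr_out fr *m x).
    by rewrite -{1}Px span_projE mulmxDl -[_ *m gr_out fr *m x]mulmxA.
  have Qp0 : gr_out fr *m (val p' *m (core_proj fr *m x)) = 0.
    rewrite [val p' *m _]mulmxA p1 -2!mulmxA [gr_out fr *m _]mulmxA.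
    by rewrite (gr_out_core_proj fr) mul0mx.
  rewrite (val_grGL Pp') /gr_mx [in RHS]xE [val p' *m _]mulmxDr [RHS]mulmxDr Qp0.
  by rewrite add0r !mulmxA.
move=> Pp; apply/seteqP; split; first exact: sub.
move=> x Lx; apply/mem_act_sub.
have := sub p^-1%g _ (flag_stabV Pp) _ (ex_intro2 _ _ x Lx erefl).
by rewrite mulgA -(grGLM (flag_stabV Pp) Pp) mulVg grGL1 mul1g.
Qed.

End FlagStabiliser.
End Lattices.

(** * Local triviality *)

Section GLLimits.
Variables (K : fieldType) (T : Type) (G : set_system T).
Context {FG : Filter G}.

(** Matrix convergence of a [GL]-valued function, kept separate from [cvg] so
    that the limit laws of [mxlim] apply by conversion. *)
Definition GLlim p (f : T -> GL K p) (g : GL K p) : Prop :=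
  mxlim G (fun x => val (f x)) (val g).

Lemma mxlim_near_eq p q (f f' : T -> 'M[laurent K]_(p, q)) X :
  (\forall x \near G, f x = f' x) -> mxlim G f X -> mxlim G f' X.
Proof. by move=> ff' fX m; apply: filterS2 ff' (fX m) => x ->. Qed.

Lemma GLlimM p (f f' : T -> GL K p) g g' :
  GLlim f g -> GLlim f' g' -> GLlim (fun x => f x * f' x)%g (g * g')%g.
Proof. exact: mxlimM. Qed.

Lemma GLlimV p (f : T -> GL K p) g : GLlim f g -> GLlim (fun x => (f x)^-1)%g g^-1%g.
Proof. exact: (mxlimV (valP g)). Qed.

Lemma GLlim_cst p (g : GL K p) : GLlim (fun=> g) g.
Proof. exact: mxlim_cst. Qed.

Lemma GLlim_nbhs p (f : T -> GL K p) g (W : set (GL K p)) :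
  GLlim f g -> nbhs g W -> \forall x \near G, W (f x).
Proof. by move=> fg /nbhs_GLP[m mW]; apply: filterS (fg m) => x /mW. Qed.

End GLLimits.

Section CellLimits.
Variables (K : fieldType) (n k r : nat) (fr : frame (laurent K) n k r).

Lemma GLlim_mulr (g1 : GL K n) :
  GLlim (nbhs (1%g : GL K n)) (fun g => (g * g1)%g) g1.
Proof.
rewrite -[X in GLlim _ _ X]mul1g.
exact: GLlimM (mxlim_val (1%g : GL K n)) (GLlim_cst g1).
Qed.

Section General.
Variables (T : Type) (G : set_system T).
Context {FG : Filter G}.
Implicit Types (f : T -> 'M[laurent K]_n) (X : 'M[laurent K]_n).

Lemma compression_lim P f X : mxlim G f X ->
  mxlim G (fun x => compression P (f x)) (compression P X).
Proof.
move=> fX; rewrite /compression; apply: mxlimD (mxlim_cst _).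
exact: mxlimM (mxlimM (mxlim_cst P) fX) (mxlim_cst P).
Qed.

Lemma graph_map_lim P f X : compression P X \in unitmx -> mxlim G f X ->
  mxlim G (fun x => graph_map P (f x)) (graph_map P X).
Proof.
move=> Xu fX.
have fV : mxlim G (fun x => invmx (compression P (f x)))
    (invmx (compression P X)).
  exact: mxlimV Xu (compression_lim P fX).
exact: mxlimM (mxlimM (mxlimM fX (mxlim_cst P)) fV) (mxlim_cst P).
Qed.

Lemma cell_section_lim f X : in_cell fr X -> mxlim G f X ->
  mxlim G (fun x => cell_section fr (f x)) (cell_section fr X).
Proof.
case=> X1 X2 fX; rewrite /cell_section; apply: mxlimD (mxlim_cst _).
apply: mxlimD (graph_map_lim X1 fX) _.
exact: mxlimM (graph_map_lim X2 fX) (mxlim_cst _).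
Qed.

End General.

Lemma in_cell_near (g1 : GL K n) : in_cell fr (val g1) ->
  \forall g \near (1%g : GL K n), in_cell fr (val (g * g1)%g).
Proof.
case=> c1 c2; have l := GLlim_mulr g1.
apply: filterS2 (mxlim_unit c1 (compression_lim _ l)) (mxlim_unit c2 (compression_lim _ l)).
by move=> g u1 u2; exact: (conj u1 u2).
Qed.

End CellLimits.

Section LocalTriviality.
Variables (K : fieldType) (n k r : nat).
Variables (fr : frame (laurent K) n k r) (F : flag K n).
Hypothesis hF : flag_at fr F.
Hypothesis hL : is_submodule (lattice_at fr 1%g).
Local Notation P := (act_stab (act_flag K n) F).
Local Notation L := (lattice_at fr).
Local Notation O := (act_orbit (act_sub K n) (L 1%g)).
Local Notation Gr := (affine_grassmannian K r).
Implicit Types (g p : GL K n) (h : GL K r) (N : set 'cV[laurent K]_n).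

Lemma orbit_submodule N : O N -> is_submodule N.
Proof. by case=> g _ <-; apply: act_sub_submodule. Qed.

Lemma lattice_lift h : act_sub K n (gr_liftGL fr h) (L 1%g) = L h.
Proof. by rewrite (act_lattice_at hF _ (gr_liftGL_stab hF h)) (grGL_lift hF) mulg1. Qed.

Lemma lattice_in_orbit h : O (L h).
Proof. by exists (gr_liftGL fr h) => //; apply: lattice_lift. Qed.

Lemma rho_lattice h : rho (L h) = F.
Proof. exact: rho_lattice_at (orbit_submodule (lattice_in_orbit h)) hF. Qed.

(** If [g] carries the base point to a submodule over the same flag, then
    [g] stabilises the flag, and [act_lattice_at] applies. *)
Lemma orbit_fibreP N : O N -> rho N = F -> exists h, N = L h.
Proof.
case=> g _ <-; rewrite (rho_act g hL) rho_lattice => Pg.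
exists (grGL fr g * 1)%g; exact: (act_lattice_at hF _ Pg).
Qed.

Definition cell_sectionGL g : GL K n :=
  locked (insubd (1%g : GL K n) (cell_section fr (val g))).

Lemma val_cell_sectionGL g : in_cell fr (val g) ->
  val (cell_sectionGL g) = cell_section fr (val g).
Proof.
move=> gc; rewrite /cell_sectionGL -lock insubdK // unfold_in.
exact: cell_section_unit.
Qed.

(** [g^-1 s] preserves both steps, hence stabilises [F]. *)
Lemma cell_sectionGL_flag g : in_cell fr (val g) ->
  act_flag K n (cell_sectionGL g) F = act_flag K n g F.
Proof.
move=> gc; have Pp : P (g^-1 * cell_sectionGL g)%g.
  apply/(flag_stabP _ hF).
  have -> : val (g^-1 * cell_sectionGL g)%g = val g^-1%g *m cell_section fr (val g).
    exact: congr2 erefl (val_cell_sectionGL gc).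
  exact: (cell_section_preserves fr (GL_mulVx g)).
by rewrite -{2}Pp -act_flagM mulgA mulgV mul1g.
Qed.

Lemma cell_sectionGL_eq g g' : in_cell fr (val g) ->
  act_flag K n g F = act_flag K n g' F ->
  in_cell fr (val g') /\ cell_sectionGL g' = cell_sectionGL g.
Proof.
move=> gc E; have Pp : P (g^-1 * g')%g.
  by rewrite /act_stab /= act_flagM -E -act_flagM mulVg act_flag1.
have /(flag_stabP _ hF) pp := Pp.
have gE : val g' = val g *m val (g^-1 * g')%g by rewrite -GL_valM mulgA mulgV mul1g.
split; first by rewrite gE; apply: in_cell_stable pp (GL_mulVx _) gc.
by rewrite /cell_sectionGL gE (cell_section_stable pp (GL_mulVx _) gc).
Qed.

Definition cell : set (flag K n) :=
  [set F' | exists g, in_cell fr (val g) /\ F' = act_flag K n g F].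

(** A flag in the cell determines [cell_sectionGL g] although it does not
    determine [g], so the choice made by [xget] is harmless. *)
Definition local_section (F' : flag K n) : GL K n :=
  xget 1%g [set s | exists g,
    [/\ in_cell fr (val g), F' = act_flag K n g F & s = cell_sectionGL g]].

Lemma local_sectionE g : in_cell fr (val g) ->
  local_section (act_flag K n g F) = cell_sectionGL g.
Proof.
move=> gc; rewrite /local_section.
case: xgetP => [s _ [g' [gc' E ->]]|/(_ (cell_sectionGL g))].
  by have [_] := cell_sectionGL_eq gc E.
by case; exists g.
Qed.

(** Translate [N] back to the fibre over [F] along the section, and read off
    the coset there. *)
Definition fibre_coord N : set (GL K r) :=
  coset_of_lattice fr (act_sub K n (local_section (rho N))^-1%g N).

Definition chart_inv (x : flag K n * set (GL K r)) : set 'cV[laurent K]_n :=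
  act_sub K n (local_section x.1) (lattice_of_coset fr x.2).

Lemma rho_section g h : in_cell fr (val g) ->
  rho (act_sub K n (cell_sectionGL g) (L h)) = act_flag K n g F.
Proof.
move=> gc; rewrite rho_act ?rho_lattice ?cell_sectionGL_flag //.
exact: orbit_submodule (lattice_in_orbit h).
Qed.

Lemma fibre_coord_section g h : in_cell fr (val g) ->
  fibre_coord (act_sub K n (cell_sectionGL g) (L h)) = ltranslate h (GLO K r).
Proof.
move=> gc; rewrite /fibre_coord rho_section // local_sectionE //.
by rewrite (actK (@act_sub1 K n) (@act_subM K n)) coset_of_latticeE.
Qed.

Lemma chart_inv_section g h : in_cell fr (val g) ->
  chart_inv (act_flag K n g F, ltranslate h (GLO K r)) = act_sub K n (cell_sectionGL g) (L h).
Proof. by move=> gc; rewrite /chart_inv /= local_sectionE // lattice_of_cosetE. Qed.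

(** Every point of the orbit over the cell is a translate along the
    section of a unique point of the fibre; this reduces statements about
    [fibre_coord] and [chart_inv] to [fibre_coord_section] and
    [chart_inv_section]. *)
Lemma orbit_over_cellP N : O N -> cell (rho N) -> exists g h,
  in_cell fr (val g) /\ N = act_sub K n (cell_sectionGL g) (L h).
Proof.
move=> ON [g [gc E]]; exists g.
have [|h hE] := orbit_fibreP (act_orbit_act (@act_subM K n) (cell_sectionGL g)^-1%g ON).
  rewrite (rho_act _ (orbit_submodule ON)) E -cell_sectionGL_flag //.
  exact: (actK (@act_flag1 K n) (@act_flagM K n)).
exists h; split=> //; rewrite -hE.
by rewrite (actKV (@act_sub1 K n) (@act_subM K n)).
Qed.

Lemma cell_sectionGL_lim g1 : in_cell fr (val g1) ->
  GLlim (nbhs (1%g : GL K n)) (fun g => cell_sectionGL (g * g1)%g) (cell_sectionGL g1).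
Proof.
move=> gc.
have sl : mxlim (nbhs (1%g : GL K n))
    (fun g => cell_section fr (val (g * g1)%g)) (val (cell_sectionGL g1)).
  by rewrite (val_cell_sectionGL gc); apply: cell_section_lim gc (GLlim_mulr g1).
apply: mxlim_near_eq sl; apply: filterS (in_cell_near gc) => g gg1.
exact: esym (val_cell_sectionGL gg1).
Qed.

(** The discrepancy between moving by [g] and moving along the section; it
    stabilises [F] and tends to 1 with [g]. *)
Definition twist g1 g : GL K n :=
  ((cell_sectionGL (g * g1))^-1 * (g * cell_sectionGL g1))%g.

Lemma twist_stab g1 g : in_cell fr (val g1) -> in_cell fr (val (g * g1)%g) ->
  P (twist g1 g).
Proof.
move=> gc gc'; rewrite /act_stab /= /twist act_flagM (act_flagM g) (cell_sectionGL_flag gc).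
by rewrite -(act_flagM g) -(cell_sectionGL_flag gc') (actK (@act_flag1 K n) (@act_flagM K n)).
Qed.

(** In the trivialisation, a small [g] moves the base point by [g] and the
    fibre coordinate by the matrix that [twist] induces on the quotient. *)
Lemma act_section g1 g h : in_cell fr (val g1) -> in_cell fr (val (g * g1)%g) ->
  act_sub K n g (act_sub K n (cell_sectionGL g1) (L h)) =
  act_sub K n (cell_sectionGL (g * g1)%g) (L (grGL fr (twist g1 g) * h)%g).
Proof.
move=> gc gc'; rewrite -(act_lattice_at hF _ (twist_stab gc gc')) /twist.
rewrite (act_subM (cell_sectionGL (g * g1))^-1%g).
by rewrite [RHS](actKV (@act_sub1 K n) (@act_subM K n)) (act_subM g).
Qed.

Lemma grGL_twist_lim g1 : in_cell fr (val g1) ->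
  GLlim (nbhs (1%g : GL K n)) (fun g => grGL fr (twist g1 g)) 1%g.
Proof.
move=> gc; have tw : GLlim (nbhs (1%g : GL K n))
    (fun g => (cell_sectionGL (g * g1))^-1 * (g * cell_sectionGL g1))%g
    ((cell_sectionGL g1)^-1 * cell_sectionGL g1)%g.
  exact: GLlimM (GLlimV (cell_sectionGL_lim gc)) (GLlim_mulr (cell_sectionGL g1)).
rewrite [X in GLlim _ _ X]mulVg in tw.
have E : \forall g \near (1%g : GL K n),
    gr_mx fr (val (twist g1 g)) = val (grGL fr (twist g1 g)).
  apply: filterS (in_cell_near gc) => g gg1.
  exact: esym (val_grGL hF (twist_stab gc gg1)).
apply: mxlim_near_eq E _; rewrite /GLlim GL_val1 -(gr_mx1 fr).
exact: mxlimM (mxlimM (mxlim_cst _) tw) (mxlim_cst _).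
Qed.

Lemma gr_liftGL_lim : GLlim (nbhs (1%g : GL K r)) (gr_liftGL fr) 1%g.
Proof.
rewrite /GLlim GL_val1 -(gr_lift1 fr).
apply: mxlimD (mxlim_cst _) _.
exact: mxlimM (mxlimM (mxlim_cst _) (mxlim_val 1%g)) (mxlim_cst _).
Qed.

(** By [act_section], moving [N] by [g] multiplies its fibre
    coordinate by a matrix that tends to 1. *)
Lemma fibre_coord_continuous N : O N -> cell (rho N) ->
  {for (N : submodule_space K n),
    continuous (fibre_coord : submodule_space K n -> coset_space K r)}.
Proof.
move=> ON cN; have [g1 [h0 [gc ->]]] := orbit_over_cellP ON cN.
move=> W; rewrite fibre_coord_section //.
move=> /(nbhs_orbitP (@ltranslate1 _) (@ltranslateM _)) W1.
apply/(nbhs_orbitP (@act_sub1 K n) (@act_subM K n)).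
apply: filterS2 (in_cell_near gc) (GLlim_nbhs (grGL_twist_lim gc) W1) => g gg1 /=.
by rewrite act_section // fibre_coord_section // ltranslateM.
Qed.

(** Moving the flag by [g] and the coset by [h] moves the image by
    [s(g g1) h' s(g1)^-1], where [s] is the section and [h'] the lift of [h]; this
    tends to 1 as [(g, h)] does. *)
Lemma chart_inv_continuous (F' : flag K n) c : cell F' -> Gr c ->
  {for ((F', c) : flag_space K n * coset_space K r),
    continuous (chart_inv : flag_space K n * coset_space K r -> submodule_space K n)}.
Proof.
move=> [g1 [gc ->]] [h0 _ <-] W; rewrite chart_inv_section //.
move=> /(nbhs_orbitP (@act_sub1 K n) (@act_subM K n)) W1.
pose R (x : GL K n * GL K r) : GL K n :=
  (cell_sectionGL (x.1 * g1) * gr_liftGL fr x.2 * (cell_sectionGL g1)^-1)%g.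
have Rlim : GLlim (filter_prod (nbhs (1%g : GL K n)) (nbhs (1%g : GL K r))) R
    (cell_sectionGL g1 * 1 * (cell_sectionGL g1)^-1)%g.
  apply: GLlimM (GLlim_cst (cell_sectionGL g1)^-1%g); apply: GLlimM.
    exact: mxlim_comp cvg_fst (cell_sectionGL_lim gc).
  exact: mxlim_comp cvg_snd gr_liftGL_lim.
rewrite [X in GLlim _ _ (X * _)%g]mulg1 [X in GLlim _ _ X]mulgV in Rlim.
have [[A B] [/= A1 B1] AB] := GLlim_nbhs Rlim W1.
(* Shrink [A] so that the flags reached stay in the cell. *)
have {}A1 := @filterI _ _ (nbhs_filter (1%g : GL K n)) _ _ A1 (in_cell_near gc).
exists ([set act_flag K n (g * g1)%g F | g in A `&` [set g | in_cell fr (val (g * g1)%g)]],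
        [set ltranslate (h * h0)%g (GLO K r) | h in B]).
  split; [apply/(nbhs_orbitP (@act_flag1 K n) (@act_flagM K n)) |
          apply/(nbhs_orbitP (@ltranslate1 _) (@ltranslateM _))].
    by apply: filterS A1 => g gA; exists g => //; rewrite act_flagM.
  by apply: filterS B1 => h hB; exists h => //; rewrite ltranslateM.
move=> [_ _] /= [[g [Ag gg1] <-] [h Bh <-]].
rewrite chart_inv_section //; have := AB (g, h) (conj Ag Bh).
rewrite /R /= act_subM (actK (@act_sub1 K n) (@act_subM K n)) act_subM.
by rewrite (act_lattice_at hF _ (gr_liftGL_stab hF h)) (grGL_lift hF).
Qed.

Lemma cell_open : open (cell : set (flag_space K n)).
Proof.
rewrite openE => _ [g1 [gc ->]].
apply/(nbhs_orbitP (@act_flag1 K n) (@act_flagM K n)).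
apply: filterS (in_cell_near gc) => g gg1 /=.
by exists (g * g1)%g; rewrite act_flagM.
Qed.

Lemma rho_continuous N : is_submodule N ->
  {for (N : submodule_space K n),
    continuous (@rho K n : submodule_space K n -> flag_space K n)}.
Proof.
move=> hN W /(nbhs_orbitP (@act_flag1 K n) (@act_flagM K n)) W1.
apply/(nbhs_orbitP (@act_sub1 K n) (@act_subM K n)).
by apply: filterS W1 => g /=; rewrite rho_act.
Qed.

(** All the sets involved are open, so continuity within them is
    continuity at their points. *)
Lemma local_homeomorphism (B : set (flag_space K n)) : open B -> cell `<=` B ->
  homeomorphism_on (O `&` (@rho K n) @^-1` cell : set (submodule_space K n))
    ((B `&` cell) `*` (Gr : set (coset_space K r)))
    (fun N => (rho N : flag_space K n, fibre_coord N : coset_space K r)).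
Proof.
move=> oB cB.
have oO : open (O : set (submodule_space K n)).
  exact: act_orbit_open (@act_sub1 K n) (@act_subM K n) _.
have oGr : open (Gr : set (coset_space K r)).
  exact: (act_orbit_open (@ltranslate1 _) (@ltranslateM _) (GLO K r)).
have oE : open (O `&` (@rho K n) @^-1` cell : set (submodule_space K n)).
  rewrite openE => N [ON cN]; apply: filterI; first exact: open_nbhs_nbhs.
  apply: (rho_continuous (orbit_submodule ON)).
  by apply: open_nbhs_nbhs; split=> //; apply: cell_open.
have fibre_coordK N : O N -> cell (rho N) -> chart_inv (rho N, fibre_coord N) = N.
  move=> ON cN; have [g1 [h0 [gc ->]]] := orbit_over_cellP ON cN.
  by rewrite rho_section // fibre_coord_section // chart_inv_section.
split.
- split.
  + move=> N [ON cN]; split; first by split=> //; apply: cB.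
    have [g1 [h0 [gc ->]]] := orbit_over_cellP ON cN.
    by rewrite /= fibre_coord_section //; exists h0.
  + move=> N N' /set_mem[ON cN] /set_mem[ON' cN'] E.
    apply: etrans (esym (fibre_coordK N ON cN)) _.
    exact: etrans (congr1 chart_inv E) (fibre_coordK N' ON' cN').
  + move=> [_ _] [/= [_ [g [gc ->]]] [h _ <-]].
    exists (act_sub K n (cell_sectionGL g) (L h)); last first.
      by rewrite rho_section // fibre_coord_section.
    split; last by rewrite /= rho_section //; exists g.
    exact: (act_orbit_act (@act_subM K n) (cell_sectionGL g) (lattice_in_orbit h)).
- rewrite continuous_open_subspace // => N /set_mem[ON cN].
  exact: (@cvg_pair _ _ _ (nbhs (N : submodule_space K n))
    (nbhs (rho N : flag_space K n)) (nbhs (fibre_coord N : coset_space K r)) _ _ _ _ _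
    (rho_continuous (orbit_submodule ON)) (fibre_coord_continuous ON cN)).
- exists chart_inv; first by move=> N /set_mem[ON cN]; apply: fibre_coordK.
  rewrite continuous_open_subspace; last first.
    rewrite openE => -[F' c] [BcF' Gc]; exists (B `&` cell, Gr) => //=.
    by split; apply: open_nbhs_nbhs; split=> //; apply: openI oB cell_open.
  by move=> [F' c] /set_mem[[_ cF'] Gc]; apply: chart_inv_continuous.
Qed.

End LocalTriviality.

(** * Frames adapted to a basis, and the main theorem *)

Lemma mulmx_sum_col (R : comNzRingType) m n (X : 'M[R]_(m, n)) (z : 'cV_n) :
  X *m z = \sum_j z j 0 *: col j X.
Proof.
apply/matrixP => i j; rewrite ord1 mxE summxE; apply: eq_bigr => l _.
by rewrite !mxE mulrC.
Qed.

Lemma col_block_in (F : fieldType) n (X : 'M[F]_n) off m (j : 'I_m)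
  (ltn : (off + j < n)%N) : col j (X *m block_in F n off m) = col (Ordinal ltn) X.
Proof.
apply/matrixP => i l; rewrite !mxE (bigD1 (Ordinal ltn)) //= !mxE eqxx mulr1.
rewrite big1 ?addr0 // => s; rewrite -val_eqE /= => /negbTE E.
by rewrite mxE E mulr0.
Qed.

Section AdaptedFrames.
Variables (K : fieldType) (n : nat).
Local Notation A := (laurent K).
Local Notation iota := (@laurent_of_fps K).
Local Notation V := 'cV[A]_n.
Implicit Types a b : seq V.

(** The sizes are required so that no column is compared with a default
    value of [nth]. *)
Definition adapted k r (fr : frame A n k r) a b : Prop :=
  [/\ size a = k, size b = r, forall j, col j (core_in fr) = a`_j
    & forall j, col j (gr_in fr) = b`_j].

Lemma adapted_frame k r a b (krn : (k + r <= n)%N) : free (a ++ b) ->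
  size a = k -> size b = r -> exists g : GL K n,
  adapted (frame_act (valP g) (standard_frame A krn)) a b.
Proof.
move=> fab sa sb; have [_ [g gE]] := free_GL fab.
have sab : size (a ++ b) = (k + r)%N by rewrite size_cat sa sb.
exists g; split=> // j.
  have jk : (j < k + r)%N by rewrite (leq_trans (ltn_ord j)) // leq_addr.
  rewrite /= (col_block_in _ (leq_trans jk krn : (0 + j < n)%N)) gE ?sab //.
  by rewrite nth_cat sa /= ltn_ord.
have jk : (k + j < k + r)%N by rewrite ltn_add2l.
rewrite /= (col_block_in _ (leq_trans jk krn)) gE ?sab //.
by rewrite nth_cat sa /= ltnNge leq_addr /= addKn.
Qed.

Lemma span_imageP m (J : 'M[A]_(n, m)) a x : size a = m ->
  (forall j : 'I_m, col j J = a`_j) -> x \in <<a>>%VS <-> exists z, x = J *m z.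
Proof.
move=> sa; case: m / sa J => J JE; split=> [xa|[z ->]].
  exists (\col_i coord (in_tuple a) i x); rewrite {1}(coord_span (X := in_tuple a) xa).
  by rewrite mulmx_sum_col; apply: eq_bigr => i _; rewrite mxE JE.
rewrite mulmx_sum_col memv_suml // => i _.
by rewrite memvZ // JE memv_span // mem_nth.
Qed.

Variables (k r : nat) (fr : frame A n k r) (a b : seq V).
Hypothesis frab : adapted fr a b.

Lemma core_projP (x : V) : core_proj fr *m x = x <-> exists z, x = core_in fr *m z.
Proof.
rewrite core_projE; split=> [<-|[z ->]]; last by rewrite -mulmxA core_out_inK.
by exists (core_out fr *m x); rewrite mulmxA.
Qed.

Lemma span_projP (x : V) :
  span_proj fr *m x = x <-> exists z y, x = core_in fr *m z + gr_in fr *m y.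
Proof.
split=> [<-|[z [y ->]]].
  exists (core_out fr *m x), (gr_out fr *m x).
  by rewrite span_projE mulmxDl core_projE !mulmxA.
by rewrite mulmxDr !mulmxA span_proj_core span_proj_gr.
Qed.

Lemma adapted_core : is_image_of <<a>>%VS (core_proj fr).
Proof.
move=> x; have [sa _ aE _] := frab.
by rewrite core_projP; apply: span_imageP.
Qed.

Lemma adapted_span : is_image_of <<a ++ b>>%VS (span_proj fr).
Proof.
move=> x; have [sa sb aE bE] := frab; rewrite span_projP span_cat; split.
  move=> /memv_addP[u /(span_imageP _ sa aE)[z ->] [v /(span_imageP _ sb bE)[y ->] ->]].
  by exists z, y.
move=> [z [y ->]]; apply: memv_add.
  by apply/(span_imageP _ sa aE); exists z.
by apply/(span_imageP _ sb bE); exists y.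
Qed.

Lemma adapted_flag : flag_at fr (<<a>>%VS, <<a ++ b>>%VS).
Proof. by split; [exact: adapted_core | exact: adapted_span]. Qed.

Lemma Ospan_imageP (x : V) :
  Ospan b x <-> exists y : 'cV[fps K]_r, x = gr_in fr *m map_mx iota y.
Proof.
have [_ sb _ bE] := frab.
have E (c : 'I_r -> fps K) (d : nat -> fps K) : (forall i : 'I_r, c i = d i) ->
    gr_in fr *m map_mx iota (\col_i c i) = \sum_(i < size b) iota (d i) *: b`_i.
  move=> cd; rewrite mulmx_sum_col sb; apply: eq_bigr => i _.
  by rewrite !mxE cd bE.
split=> [[c ->]|[y ->]]; first by exists (\col_i c i); rewrite (E _ c).
pose d i := if insub i is Some j then y j 0 else 0.
exists d; rewrite -(E (fun i => y i 0) d); last by move=> i; rewrite /d valK.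
by congr (_ *m map_mx _ _); apply/matrixP => i j; rewrite mxE ord1.
Qed.

(** The normal form of [M] says that [M] is the submodule over its own
    flag attached to the trivial coset. *)
Lemma adapted_lattice (M : set V) : spanned M a b -> M = lattice_at fr 1%g.
Proof.
have [sa _ aE _] := frab => Mab; apply/seteqP; split=> x.
  case/Mab => u [w [/(span_imageP _ sa aE)[z ->] /Ospan_imageP[y ->] ->]].
  split; first by apply/span_projP; exists z, (map_mx iota y).
  by rewrite act_sub1 mulmxDr gr_out_core_in0 gr_out_inK add0r; exists y.
rewrite /lattice_at act_sub1 => -[Px [y yE]]; apply/Mab.
exists (core_proj fr *m x), (gr_in fr *m map_mx iota y); split.
- by apply/adapted_core; rewrite mulmxA core_proj_idem.
- by apply/Ospan_imageP; exists y.
- by rewrite -{1}Px span_projE mulmxDl -yE mulmxA.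
Qed.

End AdaptedFrames.

Lemma flag_basis (K : fieldType) n k r l (F : flag K n) : flag_variety K n k r l F ->
  exists a b : seq 'cV[laurent K]_n, [/\ free (a ++ b), size a = k, size b = r
    & F = (<<a>>%VS, <<a ++ b>>%VS)].
Proof.
case: F => U W [/= UW dU dWU _].
exists (vbasis U), (vbasis (W :\: U)).
have UE : (U + (W :\: U))%VS = W by rewrite addvC addv_diff; apply/addv_idPl.
have bb : basis_of W (vbasis U ++ vbasis (W :\: U)).
  rewrite -{1}UE; apply: cat_basis; rewrite ?vbasisP //.
  by apply/directv_addP; rewrite capvC capv_diff.
have sb : \dim W = (\dim U + \dim (W :\: U))%N.
  have := size_basis (X := in_tuple (vbasis U ++ vbasis (W :\: U))) bb.
  by rewrite size_cat !size_tuple.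
split; first exact: basis_free bb.
- by rewrite size_tuple.
- by rewrite size_tuple -dWU sb addKn.
- by rewrite (span_basis bb) (span_basis (vbasisP U)).
Qed.

(** Every set stable under the group is open in the orbit topology. *)
Lemma flag_variety_open (K : fieldType) n d1 d2 d3 :
  open (flag_variety K n d1 d2 d3 : set (flag_space K n)).
Proof.
rewrite openE => F FB; apply/(nbhs_orbitP (@act_flag1 K n) (@act_flagM K n)).
by apply: filterE => g; apply: act_flag_variety.
Qed.

Lemma cell_flag_variety (K : fieldType) n k r (fr : frame (laurent K) n k r) F d1 d2 d3 :
  flag_variety K n d1 d2 d3 F -> cell fr F `<=` flag_variety K n d1 d2 d3.
Proof. by move=> FB _ [g [_ ->]]; apply: act_flag_variety. Qed.

Section Assembly.
Variables (K : fieldType) (n k r l : nat) (M : set 'cV[laurent K]_n).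
Hypothesis hM : is_submodule M.
Local Notation B := (flag_variety K n k r l).
Local Notation O_M := (act_orbit (act_sub K n) M).
Local Notation Gr := (affine_grassmannian K r).

Hypothesis rhoM : B (rho M).
Hypothesis framed : forall F, B F -> exists fr : frame (laurent K) n k r,
  flag_at fr F /\ O_M (lattice_at fr 1%g).

Lemma fibre_bundle_rho :
  @fibre_bundle (submodule_space K n) (flag_space K n) (coset_space K r)
            O_M B Gr (@rho K n).
Proof.
have sub N : O_M N -> is_submodule N by case=> g _ <-; apply: act_sub_submodule.
split.
- apply/seteqP; split=> [_ [_ [g _ <-] <-]|F FB].
    by rewrite rho_act //; apply: act_flag_variety.
  have [fr [hF OL]] := framed FB; exists (lattice_at fr 1%g) => //.
  exact: rho_lattice_at (sub _ OL) hF.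
- rewrite continuous_open_subspace; last first.
    exact: act_orbit_open (@act_sub1 K n) (@act_subM K n) M.
  by move=> N /set_mem/sub; apply: rho_continuous.
- move=> F FB; have [fr [hF OL]] := framed FB.
  exists (cell fr F); split.
  + exact: cell_open.
  + by exists 1%g; rewrite act_flag1; split=> //; apply: in_cell1.
  + exists (fibre_coord fr F); rewrite -(act_orbit_eq (@act_sub1 K n) (@act_subM K n) OL).
    apply: local_homeomorphism => //; first exact: sub.
    - exact: flag_variety_open.
    - exact: cell_flag_variety.
Qed.

Lemma fibre_affine_grassmannian F : B F ->
  let P := act_stab (act_flag K n) F in
  exists (q : GL K n -> GL K r) (f : set (GL K r) -> set 'cV[laurent K]_n),
    [/\ forall p p', P p -> P p' -> q (p * p')%g = (q p * q p')%g,
        q @` P = setT,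
        set_bij Gr (O_M `&` [set N | rho N = F]) f &
        forall p c, P p -> Gr c -> f (ltranslate (q p) c) = act_sub K n p (f c)].
Proof.
move=> FB; have [fr [hF OL]] := framed FB => P.
have OE := act_orbit_eq (@act_sub1 K n) (@act_subM K n) OL.
have hL : is_submodule (lattice_at fr 1%g).
  by case: OL => g _ <-; apply: act_sub_submodule.
exists (grGL fr), (lattice_of_coset fr); split.
- exact: grGLM hF.
- apply/seteqP; split=> // h _; exists (gr_liftGL fr h); first exact: gr_liftGL_stab.
  exact: grGL_lift hF h.
- rewrite -OE; split.
  + move=> _ [h _ <-]; rewrite lattice_of_cosetE; split; last exact: rho_lattice hF hL h.
    exact: lattice_in_orbit hF h.
  + move=> _ _ /set_mem[h _ <-] /set_mem[h' _ <-]; rewrite !lattice_of_cosetE.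
    exact: lattice_at_coset.
  + move=> N [ON /= rN]; have [h ->] := orbit_fibreP hF hL ON rN.
    by exists (ltranslate h (GLO K r)); [exists h | exact: lattice_of_cosetE].
- move=> p _ Pp [h _ <-]; rewrite -ltranslateM !lattice_of_cosetE.
  by rewrite (act_lattice_at hF).
Qed.

End Assembly.

(** When [k = 0] and [r = n] the matrix [gr_in] is square and invertible, and
    the condition defining [lattice_at] in terms of [span_proj] is vacuous. *)
Lemma full_lattice (K : fieldType) n (fr : frame (laurent K) n 0 n) :
  exists g : GL K n, lattice_at fr 1%g = act_sub K n g (@standard_lattice K n).
Proof.
have JQ : gr_in fr *m gr_out fr = 1%:M by apply: mulmx1C; apply: gr_outK.
have Ju : gr_in fr \in unitmx := (mulmx1_unit JQ).1.
exists (exist (fun X : 'M_n => is_true (X \in unitmx)) _ Ju).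
have P1 : span_proj fr = 1%:M.
  rewrite span_projE core_projE JQ.
  by rewrite (flatmx0 (core_out fr)) mulmx0 add0r.
apply/seteqP; split=> x.
  rewrite /lattice_at P1 act_sub1 => -[_ xO]; exists (gr_out fr *m x) => //.
  by rewrite /= mulmxA JQ mul1mx.
case=> y yO <-; split; first by rewrite P1 mul1mx.
by rewrite act_sub1 /= gr_out_inK.
Qed.

Theorem corollary5p3 (K : fieldType) (n : nat) (M : set 'cV[laurent K]_n)
    (hM : is_submodule M) (k r l : nat)
    (hk : k = \dim (core M))
    (hr : r = (\dim (span_set M) - \dim (core M))%N)
    (hl : l = (n - k - r)%N) :
  let G := GL K n in
  let O_M := act_orbit (act_sub K n) M in
  let G_M := act_stab (act_sub K n) M in
  [/\ (k + r + l)%N = n,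
      isomorphic_Gsets (@ltranslate G) (act_sub K n) (lcosets_of G_M) O_M,
      forall (g : G) (N : set 'cV[laurent K]_n), is_submodule N ->
        rho (act_sub K n g N) = act_flag K n g (rho N)
    & [/\ @fibre_bundle (submodule_space K n) (flag_space K n) (coset_space K r)
            O_M (flag_variety K n k r l) (affine_grassmannian K r) (@rho K n),
          forall F : flag K n, flag_variety K n k r l F ->
            let P := act_stab (act_flag K n) F in
            exists (q : G -> GL K r) (f : set (GL K r) -> set 'cV[laurent K]_n),
              [/\ forall p p', P p -> P p' -> q (p * p')%g = (q p * q p')%g,
                  q @` P = setT,
                  set_bij (affine_grassmannian K r)
                          (O_M `&` [set N | rho N = F]) f &
                  forall p c, P p -> affine_grassmannian K r c ->
                    f (ltranslate (q p) c) = act_sub K n p (f c)]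
        & r = n ->
            isomorphic_Gsets (@ltranslate G) (act_sub K n)
              (affine_grassmannian K n) O_M]].
Proof.
move=> G O_M G_M; have [a [b [fab Mab]]] := submodule_basis hM.
have [sabn _] := free_GL fab.
have krn0 : (size a + size b <= n)%N by rewrite -size_cat.
have [g0 ad0] := adapted_frame krn0 fab erefl erefl.
have rhoM : rho M = (<<a>>%VS, <<a ++ b>>%VS).
  rewrite {1}(adapted_lattice ad0 Mab); apply: rho_lattice_at (adapted_flag ad0).
  by rewrite -(adapted_lattice ad0 Mab).
have [coreE spanE] : core M = <<a>>%VS /\ span_set M = <<a ++ b>>%VS.
  exact: (conj (congr1 fst rhoM) (congr1 snd rhoM)).
have dima : \dim <<a>>%VS = size a.
  by apply/eqP; move: fab; rewrite cat_free => /and3P[].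
have dimab : \dim <<a ++ b>>%VS = (size a + size b)%N.
  by rewrite -size_cat; apply/eqP.
have ka : size a = k by rewrite hk coreE dima.
have rb : size b = r by rewrite hr coreE spanE dima dimab addKn.
have krn : (k + r <= n)%N by rewrite -ka -rb.
(* The bound [krn] makes the truncated subtraction defining [l] exact. *)
have krl : (k + r + l)%N = n by rewrite hl -subnDA subnKC.
have [g1 ad1] := adapted_frame krn fab ka rb.
have rhoB : flag_variety K n k r l (rho M).
  rewrite rhoM; split; rewrite /= ?dima ?dimab ?ka ?rb ?addKn //.
    by rewrite span_cat addvSl.
  by rewrite hl subnDA.
have framed F : flag_variety K n k r l F -> exists fr : frame (laurent K) n k r,
    flag_at fr F /\ O_M (lattice_at fr 1%g).
  move=> /flag_basis[a' [b' [fab' sa' sb' ->]]].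
  have [g ad] := adapted_frame krn fab' sa' sb'.
  eexists; split; first exact: adapted_flag ad.
  exists (g * g1^-1)%g => //; rewrite (adapted_lattice ad1 Mab) !lattice_at_act.
  by rewrite act_subM (actK (@act_sub1 K n) (@act_subM K n)).
split=> //.
- exact: orbit_stabiliser (@act_sub1 K n) (@act_subM K n) M.
- by move=> g N hN; apply: rho_act.
split.
- exact: fibre_bundle_rho.
- exact: fibre_affine_grassmannian.
- move=> rn; have k0 : k = 0%N.
    by apply/eqP; rewrite -leqn0 -(leq_add2r r) add0n {2}rn.
  have nn : (0 + n <= n)%N by [].
  have [g2 ad2] := adapted_frame nn fab (etrans ka k0) (etrans rb rn).
  have [g gE] := full_lattice (frame_act (valP g2) (standard_frame (laurent K) nn)).
  have OM : act_orbit (act_sub K n) (@standard_lattice K n) M.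
    by exists g => //; rewrite -gE -(adapted_lattice ad2 Mab).
  rewrite /O_M (act_orbit_eq (@act_sub1 K n) (@act_subM K n) OM).
  rewrite /affine_grassmannian -act_stab_standard_lattice.
  exact: orbit_stabiliser (@act_sub1 K n) (@act_subM K n) _.
Qed.
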